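(* Let $0\le a_1\le a$ be integers and let $\alpha,\beta,\gamma,\delta\in\binom{[a]}{a_1}$. Then $$\mathrm{Rh}(\alpha,\gamma,\beta,\delta)=\mathrm{Rh}(f(\alpha),f(\gamma),f(\beta),f(\delta))$$ for any bijection $f:\{\alpha,\beta,\gamma,\delta\}\to\{\alpha,\beta,\gamma,\delta\}$ (the four labels being regarded as formal symbols). In other words, all four boundary labels can be permuted freely while preserving the number of puzzles. Here $\mathrm{Rh}(\alpha,\gamma,\beta,\delta)$ is the number of rhombus-shaped puzzles with SW, NW, NE, SE labels $\alpha,\gamma,\beta,\delta$.
   Context: Strings: $\binom{[n]}{k}$ denotes the set of binary strings (words in the symbols $0,1$) of length $n$ with exactly $k$ ones. Puzzles: work in the triangular lattice in the plane, whose unit edges make angles $0^\circ,60^\circ,120^\circ$ with the $x$-axis. Edge labels are the three symbols $0$, $1$, $10$ (where $10$ is a single symbol). A unit triangle (upward- or downward-pointing) with labeled edges is an allowed piece if its three labels read clockwise are $(0,0,0)$, $(1,1,1)$, or a cyclic rotation of $(1,0,10)$. Given a convex lattice polygon (sides along lattice directions) each of whose sides is labeled by a binary string, one symbol per unit edge, read clockwise around the polygon, a puzzle with this boundary is an assignment of labels to all unit lattice edges in the polygon which agrees with the prescribed labels on the boundary and for which every unit triangle in the polygon is an allowed piece. $\mathrm{Rh}(\alpha,\gamma,\beta,\delta)$ is the number of puzzles on the rhombus of side length $a$ with top and bottom angles $60^\circ$, whose SW, NW, NE, SE sides are labeled respectively $\alpha,\gamma,\beta,\delta$, each read clockwise.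 *)

(* Defs.v *)
From HB Require Import structures.
From mathcomp Require Import all_boot.

Set Implicit Arguments.
Unset Strict Implicit.
Unset Printing Implicit Defensive.

(* In binary strings, [false] is the symbol 0 and [true] is the symbol 1. *)
Definition binary_strings (n k : nat) : {set n.-tuple bool} :=
  [set s : n.-tuple bool | count_mem true s == k].

Inductive label : Type := L0 | L1 | L10.

Definition nat_of_label (x : label) : nat :=
  match x with L0 => 0 | L1 => 1 | L10 => 2 end.

Definition label_of_nat (n : nat) : option label :=
  match n with 0 => Some L0 | 1 => Some L1 | 2 => Some L10 | _ => None end.

Lemma nat_of_labelK : pcancel nat_of_label label_of_nat.
Proof. by case. Qed.

HB.instance Definition _ := Countable.copy label (pcan_type nat_of_labelK).

Lemma label_enumP : Finite.axiom [:: L0; L1; L10].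
Proof. by case. Qed.

HB.instance Definition _ := isFinite.Build label label_enumP.

Definition label_of_bit (b : bool) : label := if b then L1 else L0.

(* The labels [x], [y], [z] of the three edges of a unit triangle, read
   clockwise from any one of them, form an allowed piece. *)
Definition allowed_piece (x y z : label) : bool :=
  (x, y, z) \in [:: (L0, L0, L0); (L1, L1, L1);
                    (L1, L0, L10); (L0, L10, L1); (L10, L1, L0)].

(* Coordinates.  Put the bottom vertex of the rhombus at the origin, let u and v
   be the unit vectors at angles 60 and 120 degrees to the x-axis, and write
   (i, j) for the lattice point i u + j v.  The rhombus of side length a with
   60 degree angles at its top and bottom has the vertices
     bottom (0, 0),  left (0, a),  top (a, a),  right (a, 0),
   and its lattice points are the (i, j) with 0 <= i, j <= a.  Its unit edges are
     - (i, j) -- (i+1, j),    at  60 degrees, with i < a and j <= a;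
     - (i, j) -- (i, j+1),    at 120 degrees, with i <= a and j < a;
     - (i, j+1) -- (i+1, j),  at   0 degrees, with i, j < a;
   a labeling consists of one finite function for each of these directions. *)
Record labeling (a : nat) := Labeling {
  edge60  : {ffun 'I_a * 'I_a.+1 -> label};
  edge120 : {ffun 'I_a.+1 * 'I_a -> label};
  edge0   : {ffun 'I_a * 'I_a -> label}
}.

Definition labeling_to_prod (a : nat) (P : labeling a) :=
  (edge60 P, edge120 P, edge0 P).

Definition labeling_of_prod (a : nat)
    (p : {ffun 'I_a * 'I_a.+1 -> label} * {ffun 'I_a.+1 * 'I_a -> label}
         * {ffun 'I_a * 'I_a -> label}) : labeling a :=
  Labeling p.1.1 p.1.2 p.2.

Lemma labeling_to_prodK (a : nat) :
  cancel (@labeling_to_prod a) (@labeling_of_prod a).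
Proof. by case. Qed.

HB.instance Definition _ (a : nat) :=
  Finite.copy (labeling a) (can_type (@labeling_to_prodK a)).

(* The index i : 'I_a, resp. its successor i+1, as a coordinate in 0 .. a. *)
Definition lo (a : nat) (i : 'I_a) : 'I_a.+1 := widen_ord (leqnSn a) i.
Definition hi (a : nat) (i : 'I_a) : 'I_a.+1 := lift ord0 i.

(* The downward triangle (i, j), (i, j+1), (i+1, j): its edges, clockwise from
   its bottom vertex (i, j), are its left, top and right edges. *)
Definition down_ok (a : nat) (P : labeling a) (i j : 'I_a) : bool :=
  allowed_piece (edge120 P (lo i, j)) (edge0 P (i, j)) (edge60 P (i, lo j)).

(* The upward triangle (i, j+1), (i+1, j+1), (i+1, j): its edges, clockwise from
   its bottom left vertex (i, j+1), are its left, right and bottom edges. *)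
Definition up_ok (a : nat) (P : labeling a) (i j : 'I_a) : bool :=
  allowed_piece (edge60 P (i, hi j)) (edge120 P (hi i, j)) (edge0 P (i, j)).

(* Clockwise, the SW side goes from bottom to left, NW from left to top, NE from
   top to right and SE from right to bottom; hence the order of the edges is
   reversed on the last two. *)
Definition boundary_ok (a : nat) (SW NW NE SE : a.-tuple bool)
    (P : labeling a) : bool :=
  [forall k : 'I_a,
    [&& edge120 P (ord0, k) == label_of_bit (tnth SW k),
        edge60 P (k, ord_max) == label_of_bit (tnth NW k),
        edge120 P (ord_max, rev_ord k) == label_of_bit (tnth NE k)
      & edge60 P (rev_ord k, ord0) == label_of_bit (tnth SE k)]].

Definition is_puzzle (a : nat) (SW NW NE SE : a.-tuple bool)
    (P : labeling a) : bool :=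
  boundary_ok SW NW NE SE P
  && [forall i : 'I_a, forall j : 'I_a, down_ok P i j && up_ok P i j].

Definition Rh (a : nat) (SW NW NE SE : a.-tuple bool) : nat :=
  #|[set P : labeling a | is_puzzle SW NW NE SE P]|.

(* The four boundary labels as formal symbols: they stay distinct even when some
   of the strings that they stand for coincide. *)
Inductive symbol : Type := Alpha | Beta | Gamma | Delta.

Definition symbol_value (T : Type) (alpha beta gamma delta : T)
    (s : symbol) : T :=
  match s with
  | Alpha => alpha
  | Beta => beta
  | Gamma => gamma
  | Delta => delta
  end.

(* Main.v *)
Require Import Defs.
From mathcomp Require Import all_boot all_algebra.
From mathcomp Require Import ring.

(* An auxiliary line carrying one of three colours crosses the puzzle.  With
   suitable crossing weights, which are polynomials in t, it can be slid across
   every unit triangle, hence across larger regions.  If it starts and ends in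
   the idle colour, it does not see one of the sides along which it runs, and it
   acts on the next one by the hopping operator H(t) = sum_d t^d H_d, in which the
   ones jump to the left over zeros, d steps in total.  Sliding the line across
   the whole rhombus moves H_d from the NW to the SE side; sliding it across the
   upper half of the rhombus moves H_d from the NW to the NE side, because the
   middle edges carry no 10 when the NW and NE strings have equal contents; a
   rotation by 180 degrees gives a move from SE to SW.  So every H_d can be moved
   freely between the four arguments of Rh.  The string 0^k 1^m is cyclic for the
   algebra generated by the H_d.  Writing e for this string and moving operators
   to a third argument u, one obtains first F(x, e, u) = F(e, x, u), and then
   F(x, y, u) = F(y, x, u). *)

Set Implicit Arguments.
Unset Strict Implicit.
Unset Printing Implicit Defensive.

Import GRing.Theory.

Local Open Scope ring_scope.

Lemma big_label (M : nmodType) (F : label -> M) :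
  \sum_x F x = F L0 + F L1 + F L10.
Proof.
by rewrite (bigD1 L0) //= (bigD1 L1) //= (big_pred1 L10) ?addrA //; case.
Qed.

(** * Crossing weights *)

Section Weights.
Variables (R : comNzRingType) (t : R).

(* The line enters in colour [s] and leaves in colour [s'], while the label of the
   edge that it crosses changes from [x] to [x'].  The labels 0, 1, 10 have the
   colours 0, 1, 2 at 60 degrees and 2, 0, 1 at 120 degrees, and the colours dual
   to 1, 2, 0 at 0 degrees; the total colour is conserved.  The weights were
   found by solving [mx_up] and [mx_down] with the colour 1 as idle colour;
   [weight120] and [weight0] are scaled by [t] to clear denominators. *)
Definition weight60 (x x' : label) (s s' : nat) : R :=
  match x, x', s, s' with
  | L0, L0, 0, 0 => t | L0, L0, 1, 1 => 1 | L0, L0, 2, 2 => 1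
  | L1, L1, 1, 1 => 1
  | L10, L10, 1, 1 => 1 | L10, L10, 2, 2 => t
  | L0, L1, 1, 0 => 1 | L1, L0, 0, 1 => t
  | L10, L1, 1, 2 => 1 | L1, L10, 2, 1 => t
  | L0, L10, 2, 0 => t | L10, L0, 0, 2 => t
  | _, _, _, _ => 0
  end.

Definition weight120 (y y' : label) (s s' : nat) : R :=
  match y, y', s, s' with
  | L0, L0, 0, 0 => t | L0, L0, 1, 1 => t
  | L1, L1, 0, 0 => -1 | L1, L1, 1, 1 => t | L1, L1, 2, 2 => t
  | L10, L10, 0, 0 => 1
  | L1, L10, 1, 0 => 1 | L10, L1, 0, 1 => t
  | L1, L0, 2, 0 => t | L0, L1, 0, 2 => t
  | _, _, _, _ => 0
  end.

Definition weight0 (z z' : label) (s s' : nat) : R :=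
  match z, z', s, s' with
  | L0, L0, 0, 0 => t ^+ 2 | L0, L0, 1, 1 => t | L0, L0, 2, 2 => t ^+ 2
  | L1, L1, 0, 0 => t | L1, L1, 1, 1 => t
  | L10, L10, 1, 1 => t
  | L0, L1, 1, 2 => t | L1, L0, 2, 1 => t ^+ 2
  | L10, L0, 0, 1 => t ^+ 2 | L0, L10, 1, 0 => t
  | _, _, _, _ => 0
  end.

Definition mx60 x x' : 'M[R]_3 := \matrix_(i, j) weight60 x x' i j.
Definition mx120 x x' : 'M[R]_3 := \matrix_(i, j) weight120 x x' i j.
Definition mx0 x x' : 'M[R]_3 := \matrix_(i, j) weight0 x x' i j.


(** A star-triangle relation: the line passes either over the two upper edges of an upward triangle
    or, below it, over its bottom edge. Each of the 27 choices of outer labels and 9 matrix entries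
    is a polynomial identity in [t], checked separately; [mx_down] is the counterpart for downward
    triangles. *)
Lemma mx_up x y z :
  \sum_x' \sum_y' (mx60 x x' * mx120 y y') *+ allowed_piece x' y' z
  = \sum_z' mx0 z' z *+ allowed_piece x y z'.
Proof.
apply/matrixP => i j; rewrite !big_label !mxE !mulmxnE.
rewrite /= -!mulmxE !mxE !big_ord_recl !big_ord0 !mxE /=.
case: i => [[|[|[|//]]] ?]; case: j => [[|[|[|//]]] ?]; (case: x; case: y; case: z; rewrite /allowed_piece /= ?mulr0n ?mulr1n; ring).
Qed.

Lemma mx_down p z q :
  \sum_z' mx0 z z' *+ allowed_piece p z' q
  = \sum_p' \sum_q' (mx120 p' p * mx60 q' q) *+ allowed_piece p' z q'.
Proof.
apply/matrixP => i j; rewrite !big_label !mxE !mulmxnE.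
rewrite /= -!mulmxE !mxE !big_ord_recl !big_ord0 !mxE /=.
case: i => [[|[|[|//]]] ?]; case: j => [[|[|[|//]]] ?]; case: p; case: z; case: q; rewrite /allowed_piece /= ?mulr0n ?mulr1n; ring.
Qed.
End Weights.

Local Close Scope ring_scope.

(** * Puzzles cut into strips *)

Fixpoint words (T : finType) (n : nat) : seq (seq T) :=
  if n is n'.+1 then [seq x :: w | x <- enum T, w <- words T n'] else [:: [::]].

Arguments words : simpl never.

Lemma big_words0 (T : finType) (M : nmodType) (F : seq T -> M) :
  (\sum_(w <- words T 0) F w = F [::])%R.
Proof. by rewrite big_seq1. Qed.

Lemma big_wordsS (T : finType) (M : nmodType) n (F : seq T -> M) :
  (\sum_(w <- words T n.+1) F w = \sum_x \sum_(w <- words T n) F (x :: w))%R.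
Proof. by rewrite /words big_allpairs_dep big_enum. Qed.

Lemma mem_words (T : finType) n (w : seq T) : (w \in words T n) = (size w == n).
Proof.
elim: n w => [|n IH] w; first by rewrite inE; case: w.
apply/allpairsP/eqP => [[[x v] [_ /= hv ->]] /=|].
  by move: hv; rewrite IH => /eqP ->.
by case: w => //= x v [hv]; exists (x, v); rewrite /= mem_enum IH hv.
Qed.

Lemma big_words_cat (T : finType) (M : nmodType) m n (F : seq T -> M) :
  (\sum_(w <- words T (m + n)) F w
  = \sum_(u <- words T m) \sum_(v <- words T n) F (u ++ v))%R.
Proof.
elim: m F => [|m IH] F; first by rewrite big_words0.
by rewrite addSn !big_wordsS; apply: eq_bigr => x _; rewrite IH.
Qed.

Lemma big_words_eq (T : finType) (M : nmodType) n (s : seq T) (F : seq T -> M) :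
  size s = n -> (\sum_(w <- words T n) F w *+ (s == w) = F s)%R.
Proof.
elim: n s F => [|n IH] [|c s] F //=; first by rewrite big_words0.
case=> hs; rewrite big_wordsS (bigD1 c) //= [X in (_ + X)%R]big1 ?addr0.
  rewrite -(IH s (fun w => F (c :: w))) //; apply: eq_bigr => w _.
  by rewrite eqseq_cons eqxx.
move=> d hd; rewrite big1 // => w _.
by rewrite eqseq_cons eq_sym (negbTE hd).
Qed.

(** The fillings of a unit rhombus with SW, NW, NE, SE labels [y], [x], [y'], [m]; here [z] is its
    horizontal diagonal. *)
Definition cell (y x y' m : label) : nat :=
  \sum_z allowed_piece y z m * allowed_piece x y' z.

(** A row of cells from the edge [x] on the NW side down to the edge [w] on the SE side; its SW and
    NE sides [ys] and [ys'] are both read downwards. *)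
Fixpoint strip (x : label) (ys ys' : seq label) (w : label) : nat :=
  match ys, ys' with
  | [::], [::] => x == w
  | y :: ys, y' :: ys' => \sum_m cell y x y' m * strip m ys ys' w
  | _, _ => 0
  end.

(** The part of a strip above a horizontal line through the diagonal of one of its cells. It ends in
    an upward triangle, so [ys'] has one more label than [ys]; [lower_strip] starts with the
    downward triangle underneath. *)
Fixpoint upper_strip (x : label) (ys ys' : seq label) (z : label) : nat :=
  match ys, ys' with
  | [::], [:: y'] => allowed_piece x y' z
  | y :: ys, y' :: ys' => \sum_m cell y x y' m * upper_strip m ys ys' z
  | _, _ => 0
  end.

Definition lower_strip (z : label) (ys ys' : seq label) (w : label) : nat :=
  if ys is y :: ys then \sum_m allowed_piece y z m * strip m ys ys' w else 0.

Lemma strip_cat x us us' ls ls' w : size us' = (size us).+1 ->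
  strip x (us ++ ls) (us' ++ ls') w
  = (\sum_z upper_strip x us us' z * lower_strip z ls ls' w)%N.
Proof.
elim: us us' x => [|u us IH] [|u' us'] x //= [].
  move=> /size0nil ->; case: ls => [|l ls] /=.
    by rewrite big1 // => z _; rewrite muln0.
  rewrite (eq_bigr (fun m =>
    (\sum_z allowed_piece x u' z * (allowed_piece l z m * strip m ls ls' w))%N)).
    by rewrite exchange_big; apply: eq_bigr => z _; rewrite big_distrr.
  move=> m _; rewrite /cell big_distrl; apply: eq_bigr => z _ /=.
  by rewrite mulnCA mulnA.
move=> h; under eq_bigr do rewrite IH // big_distrr.
rewrite exchange_big; apply: eq_bigr => z _ /=; rewrite big_distrl.
by apply: eq_bigr => m _; rewrite mulnA.
Qed.

(* In [rhombus] and [triangle], the NW string [xs] and the SW string [ys0] are read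
   backwards (top to bottom, left to bottom), while [ys], [ws] and the bottom side
   [zs] of the triangle are read clockwise. *)
Fixpoint rhombus (xs ys0 ys ws : seq label) : nat :=
  match xs, ws with
  | [::], [::] => ys0 == ys
  | x :: xs, w :: ws =>
      \sum_(ys1 <- words label (size ys)) strip x ys1 ys w * rhombus xs ys0 ys1 ws
  | _, _ => 0
  end.

Fixpoint triangle (xs ys zs : seq label) : nat :=
  match xs, zs with
  | [::], [::] => ys == [::]
  | x :: xs, z :: zs =>
      \sum_(ys1 <- words label (size xs)) upper_strip x ys1 ys z * triangle xs ys1 zs
  | _, _ => 0
  end.

Fixpoint lower_part (zs ys0 ys ws : seq label) : nat :=
  match zs, ws with
  | [::], [::] => ys0 == ys
  | z :: zs, w :: ws =>
      \sum_(ys1 <- words label (size ys).+1)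
         lower_strip z ys1 ys w * lower_part zs ys0 ys1 ws
  | _, _ => 0
  end.

(** Each strip peeled off leaves a NE side with one more edge below the cut, so the induction needs
    parallelograms whose NE side continues below it by [ls]. For [ls] empty the cut is the
    horizontal diagonal of the rhombus. *)
Lemma rhombus_split xs ys0 us ls ws : size us = size xs ->
  rhombus xs ys0 (us ++ ls) ws
  = (\sum_(zs <- words label (size xs))
      triangle xs us zs * lower_part zs ys0 ls ws)%N.
Proof.
elim: xs us ls ws => [|x xs IH] us ls ws hs.
  by rewrite (size0nil hs) big_words0 mul1n; case: ws.
case: ws => [|w ws].
  by rewrite big_wordsS big1 // => z _; rewrite big1 // => zs _ /=; rewrite muln0.
rewrite /= size_cat hs /= addSnnS big_words_cat big_wordsS.
rewrite [LHS]big_seq (eq_bigr (fun u1 =>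
  \sum_z \sum_(zs <- words label (size xs)) \sum_(l1 <- words label (size ls).+1)
   (upper_strip x u1 us z * triangle xs u1 zs) *
     (lower_strip z l1 ls w * lower_part zs ys0 l1 ws))%N); last first.
  move=> u1; rewrite mem_words => /eqP hu1.
  rewrite (eq_bigr (fun l1 => \sum_z \sum_(zs <- words label (size xs))
   (upper_strip x u1 us z * triangle xs u1 zs) *
     (lower_strip z l1 ls w * lower_part zs ys0 l1 ws))%N); last first.
    move=> l1 _; rewrite strip_cat ?hu1 // IH // big_distrl; apply: eq_bigr => z _.
    by rewrite big_distrr; apply: eq_bigr => zs _; rewrite /= mulnACA.
  by rewrite exchange_big; apply: eq_bigr => z _; rewrite exchange_big.
rewrite -big_seq exchange_big; apply: eq_bigr => z _ /=.
rewrite exchange_big; apply: eq_bigr => zs _ /=.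
rewrite big_distrl; apply: eq_bigr => u1 _ /=.
by rewrite big_distrr.
Qed.

Local Open Scope ring_scope.

(** * Sliding the line *)

Ltac mulrn_norm :=
  rewrite ?(mulrnAl, mulrnAr, mulrA) -?mulrnA;
  first [done | by rewrite mulnC | by rewrite !mulnA mulnC ?mulnA | by rewrite mulnC mulnA].

Section Intertwining.
Variables (M : pzRingType).

(** Matrices do not commute, so products must follow the line: [chain] serves for strings stored in
    the direction of travel, [rchain] for strings stored against it. *)
Fixpoint chain (A : label -> label -> M) (ws ws' : seq label) : M :=
  match ws, ws' with
  | [::], [::] => 1
  | x :: ws, x' :: ws' => A x x' * chain A ws ws'
  | _, _ => 0
  end.

Fixpoint rchain (A : label -> label -> M) (ws ws' : seq label) : M :=
  match ws, ws' with
  | [::], [::] => 1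
  | x :: ws, x' :: ws' => rchain A ws ws' * A x x'
  | _, _ => 0
  end.

Variables A B C : label -> label -> M.
Hypothesis up_rel : forall x y z,
  \sum_x' \sum_y' (A x x' * B y y') *+ allowed_piece x' y' z
  = \sum_z' C z' z *+ allowed_piece x y z'.
Hypothesis down_rel : forall p z q,
  \sum_z' C z z' *+ allowed_piece p z' q
  = \sum_p' \sum_q' (B p' p * A q' q) *+ allowed_piece p' z q'.

Let rot x y z : allowed_piece x y z = allowed_piece y z x.
Proof. by case: x; case: y; case: z. Qed.

(** The line crosses the upward triangle, runs over the horizontal diagonal, then crosses the
    downward triangle: [up_rel] followed by [down_rel]. *)
Lemma cell_rel1 x y y' m :
  \sum_x1 \sum_y1 (A x x1 * B y' y1) *+ cell y x1 y1 m
  = \sum_p \sum_q (B p y * A q m) *+ cell p x y' q.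
Proof.
transitivity (\sum_z (\sum_x1 \sum_y1 (A x x1 * B y' y1) *+ allowed_piece x1 y1 z)
                *+ allowed_piece y z m).
  rewrite [RHS](eq_bigr (fun z => \sum_x1 \sum_y1
    (A x x1 * B y' y1) *+ (allowed_piece y z m * allowed_piece x1 y1 z))).
    rewrite [RHS]exchange_big; apply: eq_bigr => x1 _ /=.
    by rewrite [RHS]exchange_big; apply: eq_bigr => y1 _ /=; rewrite -sumrMnr.
  move=> z _; rewrite -sumrMnl; apply: eq_bigr => x1 _.
  by rewrite -sumrMnl; apply: eq_bigr => y1 _; rewrite -mulrnA mulnC.
transitivity (\sum_z (\sum_z1 C z z1 *+ allowed_piece y z1 m)
                *+ allowed_piece x y' z).
  under eq_bigr do rewrite up_rel -sumrMnl.
  rewrite exchange_big; apply: eq_bigr => z _ /=; rewrite -sumrMnl.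
  by apply: eq_bigr => z1 _; rewrite -!mulrnA mulnC.
under eq_bigr do rewrite down_rel -sumrMnl.
rewrite exchange_big; apply: eq_bigr => p _ /=.
under eq_bigr do rewrite -sumrMnl.
rewrite exchange_big; apply: eq_bigr => q _ /=.
by rewrite -sumrMnr; apply: eq_bigr => z _; rewrite -!mulrnA.
Qed.

(** Allowed pieces are invariant under cyclic rotation, so both triangle relations also hold turned
    clockwise by 120 degrees, with [A], [B], [C] on the edges at 120, 0 and 60 degrees. The line now
    passes from the two right edges of the cell to the two left ones. *)
Lemma cell_rel2 x y y' m :
  \sum_y1 \sum_m1 (A y' y1 * C m m1) *+ cell y x y1 m1
  = \sum_x1 \sum_y1 (C x1 x * A y1 y) *+ cell y1 x1 y' m.
Proof.
transitivity (\sum_y1 \sum_z A y' y1 * (\sum_m1 C m m1 *+ allowed_piece z m1 y)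
                *+ allowed_piece x y1 z).
  apply: eq_bigr => y1 _.
  under [RHS]eq_bigr do rewrite big_distrr -sumrMnl /=.
  rewrite [RHS]exchange_big; apply: eq_bigr => m1 _ /=.
  rewrite -sumrMnr; apply: eq_bigr => z _.
  by rewrite mulrnAr -mulrnA (rot y).
transitivity (\sum_z2 \sum_y2 (\sum_y1 \sum_z (A y' y1 * B z2 z) *+ allowed_piece y1 z x)
    * A y2 y *+ allowed_piece z2 m y2).
  transitivity (\sum_y1 \sum_z \sum_z2 \sum_y2
    (A y' y1 * B z2 z * A y2 y) *+ allowed_piece y1 z x *+ allowed_piece z2 m y2).
    apply: eq_bigr => y1 _; apply: eq_bigr => z _.
    rewrite down_rel big_distrr -sumrMnl /=; apply: eq_bigr => z2 _.
    rewrite big_distrr -sumrMnl /=; apply: eq_bigr => y2 _.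
    by rewrite mulrnAr mulrA -!mulrnA mulnC (rot x).
  rewrite pair_big exchange_big; apply: eq_bigr => z2 _ /=.
  rewrite exchange_big; apply: eq_bigr => y2 _ /=.
  rewrite [in RHS]pair_big big_distrl -sumrMnl; apply: eq_bigr => p _ /=.
  by rewrite mulrnAl.
transitivity (\sum_z2 \sum_y2 \sum_x1
   (C x1 x * A y2 y) *+ (allowed_piece y2 z2 m * allowed_piece x1 y' z2)).
  apply: eq_bigr => z2 _; apply: eq_bigr => y2 _.
  rewrite up_rel big_distrl -sumrMnl; apply: eq_bigr => x1 _ /=.
  by rewrite mulrnAl -mulrnA mulnC -(rot y2) -(rot x1).
under eq_bigr do rewrite exchange_big.
rewrite exchange_big; apply: eq_bigr => x1 _ /=.
by rewrite exchange_big; apply: eq_bigr => y2 _; rewrite -sumrMnr.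
Qed.

Lemma strip_rel x ys1 ys w : size ys1 = size ys ->
  \sum_x' \sum_(ys' <- words label (size ys))
    (A x x' * chain B ys ys') *+ strip x' ys1 ys' w
  = \sum_(ys1' <- words label (size ys)) \sum_w'
    (chain B ys1' ys1 * A w' w) *+ strip x ys1' ys w'.
Proof.
elim: ys1 ys x => [|v vs IH] [|y ys] x //=.
  move=> _; under eq_bigr do rewrite big_words0 mulr1.
  rewrite big_words0 (bigD1 w) //= eqxx big1 ?addr0 => [|z /negbTE->//].
  rewrite (bigD1 x) //= eqxx big1 ?addr0 ?mul1r // => z.
  by rewrite eq_sym mul1r => /negbTE->.
case=> hs; have {}IH := IH ys _ hs.
transitivity (\sum_m \sum_(ys' <- words label (size ys))
   (\sum_x1 \sum_y1 (A x x1 * B y y1) *+ cell v x1 y1 m) * chain B ys ys'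
   *+ strip m vs ys' w).
  transitivity (\sum_x1 \sum_y1 \sum_m \sum_(ys' <- words label (size ys))
     (A x x1 * B y y1 *+ cell v x1 y1 m * chain B ys ys') *+ strip m vs ys' w).
    apply: eq_bigr => x1 _; rewrite big_wordsS; apply: eq_bigr => y1 _.
    rewrite exchange_big; apply: eq_bigr => ys' _ /=.
    by rewrite -sumrMnr; apply: eq_bigr => m _; mulrn_norm.
  rewrite pair_big exchange_big; apply: eq_bigr => m _ /=.
  rewrite exchange_big; apply: eq_bigr => ys' _ /=.
  by rewrite [in RHS]pair_big big_distrl -sumrMnl.
transitivity (\sum_p \sum_q (B p v * \sum_m \sum_(ys' <- words label (size ys))
   (A q m * chain B ys ys' *+ strip m vs ys' w)) *+ cell p x y q).
  rewrite [RHS]pair_big; under [RHS]eq_bigr do rewrite big_distrr -sumrMnl /=.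
  rewrite [RHS]exchange_big; apply: eq_bigr => m _ /=.
  under [RHS]eq_bigr do rewrite big_distrr -sumrMnl /=.
  rewrite [RHS]exchange_big; apply: eq_bigr => ys' _ /=.
  rewrite cell_rel1 pair_big big_distrl -sumrMnl; apply: eq_bigr => -[p q] _ /=.
  by mulrn_norm.
rewrite big_wordsS; apply: eq_bigr => p _.
under eq_bigr do rewrite IH.
under eq_bigr do rewrite big_distrr -sumrMnl /=.
rewrite exchange_big; apply: eq_bigr => vs' _ /=.
under eq_bigr do rewrite big_distrr -sumrMnl /=.
rewrite exchange_big; apply: eq_bigr => w' _ /=.
rewrite -sumrMnr; apply: eq_bigr => q _.
by mulrn_norm.
Qed.

Lemma upper_strip_rel x ys1 ys z : size ys = (size ys1).+1 ->
  \sum_(ys' <- words label (size ys)) \sum_z'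
    (chain A ys ys' * B z z') *+ upper_strip x ys1 ys' z'
  = \sum_x' \sum_(ys1' <- words label (size ys1))
    (C x' x * chain A ys1' ys1) *+ upper_strip x' ys1' ys z.
Proof.
elim: ys1 ys x => [|v vs IH] [|y ys] x //= [].
  move=> /size0nil ->; rewrite big_wordsS.
  rewrite (eq_bigr (fun y1 => \sum_z' A y y1 * B z z' *+ allowed_piece y1 z' x)).
    rewrite up_rel; apply: eq_bigr => x1 _; rewrite big_words0 /= mulr1.
    by rewrite (rot x1).
  move=> y1 _; rewrite big_words0; apply: eq_bigr => z1 _ /=.
  by rewrite mulr1 (rot x).
move=> hs; have {}IH := IH ys _ hs.
transitivity (\sum_y1 \sum_m (A y y1 * \sum_(ys' <- words label (size ys))
    \sum_z' (chain A ys ys' * B z z' *+ upper_strip m vs ys' z')) *+ cell v x y1 m).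
  rewrite big_wordsS; apply: eq_bigr => y1 _.
  under [RHS]eq_bigr do rewrite big_distrr -sumrMnl /=.
  rewrite [RHS]exchange_big; apply: eq_bigr => ys' _ /=.
  under [RHS]eq_bigr do rewrite big_distrr -sumrMnl /=.
  rewrite [RHS]exchange_big; apply: eq_bigr => z' _ /=.
  rewrite -sumrMnr; apply: eq_bigr => m _.
  by mulrn_norm.
transitivity (\sum_m \sum_(vs' <- words label (size vs))
   (\sum_y1 \sum_m1 (A y y1 * C m m1) *+ cell v x y1 m1) * chain A vs' vs
   *+ upper_strip m vs' ys z).
  transitivity (\sum_y1 \sum_m1 \sum_m \sum_(vs' <- words label (size vs))
    (A y y1 * C m m1 * chain A vs' vs) *+ cell v x y1 m1 *+ upper_strip m vs' ys z).
    apply: eq_bigr => y1 _; apply: eq_bigr => m1 _.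
    rewrite IH big_distrr -sumrMnl /=; apply: eq_bigr => m _.
    rewrite big_distrr -sumrMnl /=; apply: eq_bigr => vs' _.
    by mulrn_norm.
  rewrite pair_big exchange_big; apply: eq_bigr => m _ /=.
  rewrite exchange_big; apply: eq_bigr => vs' _ /=.
  rewrite [in RHS]pair_big big_distrl -sumrMnl; apply: eq_bigr => p _ /=.
  by mulrn_norm.
transitivity (\sum_x1 \sum_y1 \sum_m \sum_(vs' <- words label (size vs))
   (C x1 x * A y1 v * chain A vs' vs) *+ cell y1 x1 y m *+ upper_strip m vs' ys z).
  rewrite [RHS]pair_big [RHS]exchange_big; apply: eq_bigr => m _ /=.
  rewrite [RHS]exchange_big; apply: eq_bigr => vs' _ /=.
  rewrite cell_rel2 pair_big big_distrl -sumrMnl; apply: eq_bigr => p _ /=.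
  by mulrn_norm.
apply: eq_bigr => x1 _; rewrite big_wordsS; apply: eq_bigr => y1 _.
rewrite exchange_big; apply: eq_bigr => vs' _ /=.
by rewrite -sumrMnr; apply: eq_bigr => m _; mulrn_norm.
Qed.

Lemma rhombus_rel xs ys0 ys ws :
  size ws = size xs -> size ys0 = size ys ->
  \sum_(xs' <- words label (size xs)) \sum_(ys' <- words label (size ys))
    (rchain A xs xs' * chain B ys ys') *+ rhombus xs' ys0 ys' ws
  = \sum_(ys0' <- words label (size ys)) \sum_(ws' <- words label (size xs))
    (chain B ys0' ys0 * rchain A ws' ws) *+ rhombus xs ys0' ys ws'.
Proof.
move=> hx hy; elim: xs ws ys hx hy => [|x xs IH] [|w ws] ys //= hx hy.
  rewrite big_words0; under [RHS]eq_bigr do rewrite big_words0 mulr1.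
  under [LHS]eq_bigr do rewrite mul1r.
  rewrite big_words_eq //; under eq_bigr do rewrite eq_sym.
  by rewrite big_words_eq.
case: hx => hx.
transitivity (\sum_(v <- words label (size ys))
  (\sum_(xs' <- words label (size xs)) rchain A xs xs' *+ rhombus xs' ys0 v ws *
    \sum_x1 \sum_(ys' <- words label (size ys))
       (A x x1 * chain B ys ys') *+ strip x1 v ys' w)).
  rewrite big_wordsS exchange_big /= [RHS]exchange_big; apply: eq_bigr => xs' _ /=.
  under [RHS]eq_bigr do rewrite big_distrr /=.
  rewrite [RHS]exchange_big; apply: eq_bigr => x1 _ /=.
  under [RHS]eq_bigr do rewrite big_distrr /=.
  rewrite [RHS]exchange_big [LHS]big_seq [RHS]big_seq; apply: eq_bigr => ys' hys' /=.
  move: hys'; rewrite mem_words => /eqP ->; rewrite -sumrMnr; apply: eq_bigr => v _.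
  by mulrn_norm.
transitivity (\sum_(v <- words label (size ys))
  (\sum_(xs' <- words label (size xs)) rchain A xs xs' *+ rhombus xs' ys0 v ws *
    \sum_(v' <- words label (size ys)) \sum_w'
       (chain B v' v * A w' w) *+ strip x v' ys w')).
  rewrite big_seq [RHS]big_seq; apply: eq_bigr => v; rewrite mem_words => /eqP hv.
  by apply: eq_bigr => xs' _; rewrite strip_rel.
transitivity (\sum_(v' <- words label (size ys)) \sum_w'
  (\sum_(xs' <- words label (size xs)) \sum_(v <- words label (size ys))
     (rchain A xs xs' * chain B v' v) *+ rhombus xs' ys0 v ws) * A w' w *+ strip x v' ys w').
  rewrite exchange_big /=.
  under [LHS]eq_bigr do under eq_bigr do rewrite big_distrr /=.
  under [LHS]eq_bigr do rewrite exchange_big /=.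
  rewrite [LHS]exchange_big; apply: eq_bigr => v' _ /=.
  under [LHS]eq_bigr do under eq_bigr do rewrite big_distrr /=.
  under [LHS]eq_bigr do rewrite exchange_big /=.
  rewrite [LHS]exchange_big; apply: eq_bigr => w' _ /=.
  rewrite big_distrl -sumrMnl; apply: eq_bigr => xs' _ /=.
  rewrite big_distrl -sumrMnl; apply: eq_bigr => v _ /=.
  by mulrn_norm.
transitivity (\sum_(v' <- words label (size ys)) \sum_w'
  (\sum_(ys0' <- words label (size ys)) \sum_(ws' <- words label (size xs))
    (chain B ys0' ys0 * rchain A ws' ws) *+ rhombus xs ys0' v' ws')
  * A w' w *+ strip x v' ys w').
  rewrite big_seq [RHS]big_seq; apply: eq_bigr => v'; rewrite mem_words => /eqP hv.
  by apply: eq_bigr => w' _; rewrite -hv IH // hv.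
under [LHS]eq_bigr do under eq_bigr do rewrite big_distrl -sumrMnl /=.
under [LHS]eq_bigr do rewrite exchange_big /=.
rewrite exchange_big; apply: eq_bigr => ys0' _ /=.
rewrite big_wordsS exchange_big; apply: eq_bigr => w' _ /=.
under [LHS]eq_bigr do rewrite big_distrl -sumrMnl /=.
rewrite exchange_big; apply: eq_bigr => ws' _ /=.
rewrite -sumrMnr; apply: eq_bigr => v' _.
by mulrn_norm.
Qed.

(** The turned relations sweep the line leftwards, strip by strip, from the NE and bottom sides to
    the NW side. *)
Lemma triangle_rel xs ys zs : size ys = size xs -> size zs = size xs ->
  \sum_(ys' <- words label (size xs)) \sum_(zs' <- words label (size xs))
    (chain A ys ys' * chain B zs zs') *+ triangle xs ys' zs'
  = \sum_(xs' <- words label (size xs)) chain C xs' xs *+ triangle xs' ys zs.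
Proof.
elim: xs ys zs => [|x xs IH] ys [|z zs] //= hy.
  by rewrite (size0nil hy) !big_words0 mul1r.
case=> hz.
transitivity (\sum_(v <- words label (size xs)) \sum_(zs' <- words label (size xs))
  (\sum_(ys' <- words label (size ys)) \sum_z1
     (chain A ys ys' * B z z1) *+ upper_strip x v ys' z1)
  * chain B zs zs' *+ triangle xs v zs').
  under [RHS]eq_bigr do under eq_bigr do rewrite big_distrl -sumrMnl /=.
  under [RHS]eq_bigr do rewrite exchange_big /=.
  rewrite [RHS]exchange_big hy; apply: eq_bigr => ys' _ /=.
  under [RHS]eq_bigr do under eq_bigr do rewrite big_distrl -sumrMnl /=.
  under [RHS]eq_bigr do rewrite exchange_big /=.
  rewrite big_wordsS [RHS]exchange_big; apply: eq_bigr => z1 _ /=.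
  rewrite [RHS]exchange_big; apply: eq_bigr => zs' _ /=.
  rewrite -sumrMnr; apply: eq_bigr => v _.
  by mulrn_norm.
transitivity (\sum_(v <- words label (size xs)) \sum_(zs' <- words label (size xs))
  (\sum_x1 \sum_(v' <- words label (size xs))
     (C x1 x * chain A v' v) *+ upper_strip x1 v' ys z)
  * chain B zs zs' *+ triangle xs v zs').
  rewrite big_seq [RHS]big_seq; apply: eq_bigr => v; rewrite mem_words => /eqP hv.
  by apply: eq_bigr => zs' _; rewrite upper_strip_rel hv.
transitivity (\sum_x1 \sum_(v' <- words label (size xs)) (C x1 x *
  \sum_(v <- words label (size xs)) \sum_(zs' <- words label (size xs))
    (chain A v' v * chain B zs zs') *+ triangle xs v zs') *+ upper_strip x1 v' ys z).
  under [LHS]eq_bigr do under eq_bigr do rewrite big_distrl -sumrMnl /=.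
  under [LHS]eq_bigr do rewrite exchange_big /=.
  rewrite [LHS]exchange_big; apply: eq_bigr => x1 _ /=.
  under [LHS]eq_bigr do under eq_bigr do rewrite big_distrl -sumrMnl /=.
  under [LHS]eq_bigr do rewrite exchange_big /=.
  rewrite [LHS]exchange_big; apply: eq_bigr => v' _ /=.
  rewrite big_distrr -sumrMnl; apply: eq_bigr => v _ /=.
  rewrite big_distrr -sumrMnl; apply: eq_bigr => zs' _ /=.
  by mulrn_norm.
rewrite big_wordsS; apply: eq_bigr => x1 _.
transitivity (\sum_(v' <- words label (size xs)) (C x1 x *
  \sum_(xs' <- words label (size xs)) chain C xs' xs *+ triangle xs' v' zs)
   *+ upper_strip x1 v' ys z).
  rewrite big_seq [RHS]big_seq; apply: eq_bigr => v'; rewrite mem_words => /eqP hv.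
  by rewrite IH.
under eq_bigr do rewrite big_distrr -sumrMnl /=.
rewrite exchange_big [LHS]big_seq [RHS]big_seq; apply: eq_bigr => xs' hxs' /=.
move: hxs'; rewrite mem_words => /eqP ->.
rewrite -sumrMnr; apply: eq_bigr => v' _.
by mulrn_norm.
Qed.

End Intertwining.

(** * Binary words among words of labels *)

Definition bits (w : seq bool) : seq label := map label_of_bit w.

Lemma bitsP (ws : seq label) : reflect (exists w, ws = bits w) (L10 \notin ws).
Proof.
apply: (iffP idP) => [|[w ->]]; last by apply/mapP => -[[]].
elim: ws => [|x ws IH]; first by exists [::].
rewrite inE negb_or => /andP[hx /IH[w ->]].
by case: x hx => // _; [exists (false :: w) | exists (true :: w)].
Qed.

Lemma big_boolE (M : nmodType) (F : bool -> M) :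
  \sum_b F b = F true + F false.
Proof. exact: big_bool. Qed.

Lemma big_words_bits (M : nmodType) n (F : seq label -> M) :
  (forall ws, size ws = n -> L10 \in ws -> F ws = 0) ->
  \sum_(ws <- words label n) F ws = \sum_(w <- words bool n) F (bits w).
Proof.
elim: n F => [|n IH] F hF; first by rewrite !big_words0.
rewrite !big_wordsS big_label big_boolE addrC.
rewrite [X in X + _]big_seq big1 ?add0r => [|ws]; last first.
  by rewrite mem_words => /eqP hws; rewrite hF ?inE ?eqxx //= hws.
by rewrite addrC; congr (_ + _); apply: IH => ws hws h; rewrite hF ?inE ?h ?orbT //= hws.
Qed.

Lemma words_uniq (T : finType) n : uniq (words T n).
Proof.
elim: n => // n IH; apply: allpairs_uniq => //; first exact: enum_uniq.
by move=> [x u] [y v] _ _ /= [-> ->].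
Qed.

Lemma big_words_rev (T : finType) (M : nmodType) n (F : seq T -> M) :
  \sum_(w <- words T n) F (rev w) = \sum_(w <- words T n) F w.
Proof.
rewrite -(big_map rev xpredT F); apply: perm_big; apply: uniq_perm.
- by rewrite map_inj_uniq ?words_uniq //; apply: can_inj (@revK T).
- exact: words_uniq.
move=> w; rewrite -[w in LHS]revK mem_map; last exact: can_inj (@revK T).
by rewrite !mem_words size_rev.
Qed.

(** * The hopping operator *)

Section Hop.
Variables (R : comNzRingType) (t : R).

(* Every 1 of [w] may jump to the left over zeros, at most up to the place right
   after the previous 1 of [w]; [t] counts the steps.  The flags [s], [s'] tell
   whether a jump is under way at either end: its target is met first. *)
Fixpoint hop (s : bool) (w w' : seq bool) (s' : bool) : R :=
  match w, w' with
  | [::], [::] => (s == s')%:R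
  | x :: w, x' :: w' =>
      match s, x, x' with
      | false, false, false => hop false w w' s'
      | false, true, true => hop false w w' s'
      | false, false, true => hop true w w' s'
      | true, false, false => t * hop true w w' s'
      | true, true, false => t * hop false w w' s'
      | _, _, _ => 0
      end
  | _, _ => 0
  end.

Lemma hop_cat s u u' v v' s' : size u = size u' ->
  hop s (u ++ v) (u' ++ v') s' = \sum_m hop s u u' m * hop m v v' s'.
Proof.
rewrite big_boolE.
elim: u u' s => [|x u IH] [|x' u'] [] //= => [_|_|[h]|[h]].
- by rewrite mul1r mul0r addr0.
- by rewrite mul1r mul0r add0r.
- by case: x; case: x'; rewrite /= ?IH //; ring.
- by case: x; case: x'; rewrite /= ?IH //; ring.
Qed.

(** Reversal turns left jumps into right jumps, and exchanging source and target words makes them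
    left jumps again. A jump pays [t] at every place except its target, after reversal at every
    place except its source; the powers of [t] account for jumps cut off at an end. *)
Lemma hop_rev s w w' s' : size w = size w' ->
  hop s w w' s' * t ^+ s' = hop s' (rev w') (rev w) s * t ^+ s.
Proof.
elim: w w' s => [|x w IH] [|x' w'] s //= => [_|[h]].
  by case: s; case: s'; rewrite /= ?mul0r.
rewrite !rev_cons -!cats1 hop_cat ?size_rev // big_boolE.
have ht := IH w' true h; have hf := IH w' false h.
rewrite expr1 expr0 in ht hf; rewrite mulr1 in hf.
case: s; case: x; case: x' => //=; rewrite ?expr0 ?expr1 -?mulrA ?ht ?hf; ring.
Qed.

(** A jump under way at the left end has only its source inside, one under way at the right end only
    its target. With both flags off, content is preserved. *)
Lemma hop_count s w w' s' : hop s w w' s' != 0 ->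
  (count_mem true w + s' = count_mem true w' + s)%N.
Proof.
elim: w w' s => [|x w IH] [|x' w'] s //=; rewrite ?eqxx //.
  by case: s; case: s'; rewrite /= ?eqxx.
have ht z : t * z != 0 -> z != 0 by apply: contraNneq => ->; rewrite mulr0.
case: s; case: x; case: x'; rewrite ?eqxx // => /= h.
- by rewrite add0n -addnA (IH _ _ (ht _ h)) addn0 addnC.
- by rewrite !add0n (IH _ _ (ht _ h)).
- by rewrite -!addnA (IH _ _ h).
- by rewrite !add0n (IH _ _ h) addn0 addnC.
- by rewrite !add0n (IH _ _ h).
Qed.

Local Notation m60 := (mx60 t).
Local Notation m120 := (mx120 t).
Local Notation m0 := (mx0 t).

(** Flags as colours: 1 is idle, and a jump under way has colour 0 for the weights [mx60] and colour
    2 for [mx0]. *)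
Definition carry60 (s : bool) : 'I_3 := inord (~~ s).
Definition carry0 (s : bool) : 'I_3 := inord s.+1.

Let mulmx3 (P Q : 'M[R]_3) i j :
  (P * Q) i j = P i (inord 0) * Q (inord 0) j + P i (inord 1) * Q (inord 1) j
              + P i (inord 2) * Q (inord 2) j.
Proof.
rewrite -mulmxE mxE !big_ord_recl big_ord0 addr0 addrA.
by congr (P i _ * Q _ j + P i _ * Q _ j + P i _ * Q _ j);
  apply: val_inj; rewrite /= inordK.
Qed.

Let ord3P (P : 'I_3 -> Prop) :
  P (inord 0) -> P (inord 1) -> P (inord 2) -> forall i, P i.
Proof.
have h k (hk : (k < 3)%N) : inord k = Ordinal hk :> 'I_3.
  by apply: val_inj; rewrite /= inordK.
move=> + + + [[|[|[|//]]] hi]; by rewrite (h _ hi).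
Qed.

Let m60E x x' i j : (i < 3)%N -> (j < 3)%N ->
  m60 x x' (inord i) (inord j) = weight60 t x x' i j.
Proof. by move=> hi hj; rewrite mxE !inordK. Qed.

Let m120E x x' i j : (i < 3)%N -> (j < 3)%N ->
  m120 x x' (inord i) (inord j) = weight120 t x x' i j.
Proof. by move=> hi hj; rewrite mxE !inordK. Qed.

Let m0E x x' i j : (i < 3)%N -> (j < 3)%N ->
  m0 x x' (inord i) (inord j) = weight0 t x x' i j.
Proof. by move=> hi hj; rewrite mxE !inordK. Qed.

Let inord3 i j : (i < 3)%N -> (j < 3)%N ->
  (inord i == inord j :> 'I_3) = (i == j).
Proof. by move=> hi hj; rewrite -val_eqE /= !inordK. Qed.

Lemma chain60_hop s w w' s' :
  chain m60 (bits w) (bits w') (carry60 s) (carry60 s') = hop s w w' s'.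
Proof.
elim: w w' s => [|x w IH] [|x' w'] s /=; try by rewrite mxE.
  by rewrite mxE inord3; case: s; case: s'.
have hf := IH w' false; have ht := IH w' true.
rewrite /= mulmx3; rewrite /carry60 /= in hf ht *; rewrite hf ht.
by case: s; case: x; case: x'; rewrite !m60E //=; ring.
Qed.

(** Turning 0 or 1 into 10 takes colour 2 on entry, and colours 0 and 1 never produce colour 2 on
    binary labels. *)
Lemma chain60_outer s w ws' j : L10 \in ws' ->
  chain m60 (bits w) ws' (carry60 s) j = 0.
Proof.
elim: w ws' s => [|x w IH] [|x' ws'] s //=; try by rewrite mxE.
rewrite mulmx3 inE /carry60 => /orP[/eqP<-|h].
  by case: s; case: x; rewrite !m60E //=; ring.
have hf := IH ws' false h; have ht := IH ws' true h.
rewrite /carry60 /= in hf ht; rewrite hf ht.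
by case: s; case: x; case: x'; rewrite !m60E //=; ring.
Qed.

(** Turning 10 into a binary label emits colour 2, which persists to the end as long as the new
    labels are binary. *)
Lemma chain60_inner ws w i s' : (L10 \in ws) || (i == inord 2) ->
  chain m60 ws (bits w) i (carry60 s') = 0.
Proof.
elim: ws w i => [|x ws IH] [|x' w] i /=; try by rewrite mxE.
  by move=> /eqP ->; rewrite mxE /carry60 inord3; case: s'.
rewrite mulmx3 (IH w (inord 2)) ?eqxx ?orbT // mulr0 addr0 inE -orbA.
case h : (L10 \in ws); first by rewrite !IH ?h // !mulr0 addr0.
rewrite /= => /orP[/eqP<-|/eqP->].
  move: i; apply: ord3P; case: x'; rewrite !m60E //=; ring.
by case: x; case: x'; rewrite !m60E //=; ring.
Qed.

(** Leaving a binary label in colour 1 forces entry in colour 1 and an unchanged label, with weight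
    [t]. Hence a line that ends idle does not see this side; in [chain120_inner] the same follows
    from an idle start. *)
Lemma chain120_outer w ws' i :
  chain m120 (bits w) ws' i (carry60 false)
  = t ^+ size w *+ ((i == carry60 false) && (bits w == ws')).
Proof.
elim: w ws' i => [|x w IH] [|x' ws'] i /=; try by rewrite mxE ?andbT ?andbF.
rewrite mulmx3 !IH /carry60 !inord3 //= !mulr0 addr0 add0r eqseq_cons exprS.
move: i; apply: ord3P; rewrite !inord3 //; case: (bits w == ws'); rewrite ?andbF ?mulr0 //;
  by case: x; case: x'; rewrite !m120E //=; ring.
Qed.

Lemma chain120_inner w ws j :
  chain m120 ws (bits w) (carry60 false) j
  = t ^+ size w *+ ((j == carry60 false) && (bits w == ws)).
Proof.
elim: w ws => [|x w IH] [|x' ws] /=; try by rewrite mxE ?andbT ?andbF // eq_sym.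
rewrite mulmx3 /carry60 /= eqseq_cons exprS !m120E //.
have := IH ws; rewrite /carry60 /= => ->.
by case: (j == _); case: (bits w == ws); case: x; case: x'; rewrite /= ?andbF; ring.
Qed.

Lemma chain0_hop s w w' s' :
  chain m0 (bits w) (bits w') (carry0 s) (carry0 s')
  = t ^+ size w' * hop s w w' s'.
Proof.
elim: w w' s => [|x w IH] [|x' w'] s /=; try by rewrite mxE ?mulr0.
  by rewrite mxE inord3 ?mul1r; case: s; case: s'.
have hf := IH w' false; have ht := IH w' true.
rewrite /= mulmx3; rewrite /carry0 /= in hf ht *; rewrite hf ht exprS.
by case: s; case: x; case: x'; rewrite !m0E //=; ring.
Qed.

Lemma chain0_inner s ws w j : L10 \in ws ->
  chain m0 ws (bits w) (carry0 s) j = 0.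
Proof.
elim: ws w s => [|x ws IH] [|x' w] s //=; try by rewrite mxE.
rewrite mulmx3 inE /carry0 => /orP[/eqP<-|h].
  by case: s; case: x'; rewrite !m0E //=; ring.
have hf := IH w false h; have ht := IH w true h.
rewrite /carry0 /= in hf ht; rewrite hf ht.
by case: s; case: x; case: x'; rewrite !m0E //=; ring.
Qed.

Lemma mul_chain120_outer (P : 'M[R]_3) w ws' i :
  (P * chain m120 (bits w) ws') i (carry60 false)
  = P i (carry60 false) * t ^+ size w *+ (bits w == ws').
Proof.
rewrite -mulmxE mxE (bigD1 (carry60 false)) //= big1 => [|k /negbTE hk];
  rewrite chain120_outer ?hk ?mulr0 // eqxx /= addr0.
by rewrite mulrnAr.
Qed.

Lemma mul_chain120_inner (Q : 'M[R]_3) w ws j :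
  (chain m120 ws (bits w) * Q) (carry60 false) j
  = t ^+ size w * Q (carry60 false) j *+ (bits w == ws).
Proof.
rewrite -mulmxE mxE (bigD1 (carry60 false)) //= big1 => [|k /negbTE hk];
  rewrite chain120_inner ?hk ?mul0r // eqxx /= addr0.
by rewrite mulrnAl.
Qed.

End Hop.

(** * Hops across the rhombus and across its upper half *)

Lemma chain_cat (M : pzRingType) (A : label -> label -> M) u u' v v' :
  size u = size u' ->
  chain A (u ++ v) (u' ++ v') = chain A u u' * chain A v v'.
Proof.
elim: u u' => [|x u IH] [|x' u'] //=; first by rewrite mul1r.
by case=> h; rewrite IH // mulrA.
Qed.

Lemma rchain_rev (M : pzRingType) (A : label -> label -> M) ws ws' :
  size ws = size ws' -> rchain A ws ws' = chain A (rev ws) (rev ws').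
Proof.
elim: ws ws' => [|x ws IH] [|x' ws'] //= [h].
by rewrite !rev_cons -!cats1 chain_cat ?size_rev // IH //= mulr1.
Qed.

Lemma rev_bits w : rev (bits w) = bits (rev w).
Proof. by rewrite /bits map_rev. Qed.

Definition rhombus_count (SW NW NE SE : seq bool) : nat :=
  rhombus (bits (rev NW)) (bits (rev SW)) (bits NE) (bits SE).

Definition hopX (w w' : seq bool) : {poly int} := hop 'X false w w' false.

Lemma hopX_rev w w' : size w = size w' -> hopX (rev w') (rev w) = hopX w w'.
Proof. by move=> h; have := hop_rev ('X : {poly int}) false false h; rewrite !mulr1. Qed.

Local Notation X := ('X : {poly int}).
Local Notation idle := (carry60 false).

Lemma sum_hop60_outer n w (N : seq label -> nat) : size w = n ->
  \sum_(ws <- words label n)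
     rchain (mx60 X) (bits (rev w)) ws idle idle *+ N ws
  = \sum_(w' <- words bool n) hopX w w' *+ N (bits (rev w')).
Proof.
move=> hw; rewrite -big_words_rev.
rewrite (big_words_bits (F := fun ws => rchain (mx60 X) (bits (rev w)) (rev ws) idle idle *+ N (rev ws))).
  rewrite big_seq [RHS]big_seq; apply: eq_bigr => w'; rewrite mem_words => /eqP hw'.
  rewrite rev_bits rchain_rev ?size_map ?size_rev ?hw' //.
  by rewrite !rev_bits !revK chain60_hop.
move=> ws hs h; rewrite rchain_rev ?size_map ?size_rev ?hs //.
by rewrite rev_bits !revK chain60_outer // mul0rn.
Qed.

Lemma sum_hop60_inner n w (N : seq label -> nat) : size w = n ->
  \sum_(ws <- words label n)
     rchain (mx60 X) ws (bits w) idle idle *+ N ws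
  = \sum_(w' <- words bool n) hopX w w' *+ N (bits w').
Proof.
move=> hw; rewrite (big_words_bits (F := fun ws => rchain (mx60 X) ws (bits w) idle idle *+ N ws)).
  rewrite big_seq [RHS]big_seq; apply: eq_bigr => w'; rewrite mem_words => /eqP hw'.
  rewrite rchain_rev ?size_map ?size_rev ?hw' //.
  by rewrite !rev_bits chain60_hop -/(hopX _ _) hopX_rev // hw hw'.
move=> ws hs h; rewrite rchain_rev ?size_map ?size_rev ?hs //.
by rewrite rev_bits chain60_inner ?mem_rev ?h // mul0rn.
Qed.

Lemma mulXnI n (p q : {poly int}) : 'X^n * p = 'X^n * q -> p = q.
Proof. by apply: mulfI; rewrite expf_neq0 // polyX_eq0. Qed.

Lemma rhombus_NW_SE n SW NW NE SE :
  size SW = n -> size NW = n -> size NE = n -> size SE = n ->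
  \sum_(w <- words bool n) hopX NW w *+ rhombus_count SW w NE SE
  = \sum_(w <- words bool n) hopX SE w *+ rhombus_count SW NW NE w.
Proof.
move=> hSW hNW hNE hSE.
have := rhombus_rel (mx_up X) (mx_down X) (xs := bits (rev NW))
  (ys0 := bits (rev SW)) (ys := bits NE) (ws := bits SE).
rewrite !size_map !size_rev hSW hNW hNE hSE => /(_ erefl erefl).
(* With idle ends, the NE side (line above) and the SW side (line below) stay unchanged and
   contribute only ['X^n], cancelled at the end. *)
move=> /(congr1 (fun P : 'M_3 => P idle idle)).
rewrite !summxE.
under eq_bigr do (rewrite summxE; under eq_bigr do
  rewrite mulmxnE mul_chain120_outer mulrnAC).
under eq_bigr do rewrite big_words_eq ?size_map //.
under [in X in _ = X -> _]eq_bigr do (rewrite summxE; under eq_bigr do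
  rewrite mulmxnE mul_chain120_inner mulrnAC).
rewrite [in X in _ = X -> _]exchange_big /=.
under [in X in _ = X -> _]eq_bigr do rewrite big_words_eq ?size_map ?size_rev //.
rewrite hSW hNE.
under eq_bigr do rewrite mulrC -mulrnAr.
under [in X in _ = X -> _]eq_bigr do rewrite -mulrnAr.
rewrite -!big_distrr /= sum_hop60_outer // sum_hop60_inner // => h.
exact: mulXnI h.
Qed.

Definition triangle_count (NW NE : seq bool) (S : seq label) : nat :=
  triangle (bits (rev NW)) (bits NE) S.

(** The bottom side carries the weights [mx120] and is invisible to the line because [S] is binary.
    Its factor ['X^n] cancels against the one that the weights [mx0] bring in on the NW side. *)
Lemma triangle_NW_NE n NW NE S :
  size NW = n -> size NE = n -> size S = n ->
  \sum_(w <- words bool n) hopX NE w *+ triangle_count NW w (bits S)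
  = \sum_(w <- words bool n) hopX NW w *+ triangle_count w NE (bits S).
Proof.
move=> hNW hNE hS.
have := triangle_rel (mx_up X) (mx_down X) (xs := bits (rev NW))
  (ys := bits NE) (zs := bits S).
rewrite !size_map !size_rev hNW hNE hS => /(_ erefl erefl).
move=> /(congr1 (fun P : 'M_3 => P idle idle)).
rewrite !summxE.
under eq_bigr do (rewrite summxE; under eq_bigr do
  rewrite mulmxnE mul_chain120_outer mulrnAC).
under eq_bigr do rewrite big_words_eq ?size_map //.
rewrite hS; under eq_bigr do rewrite mulrC -mulrnAr.
rewrite -big_distrr /=.
rewrite (big_words_bits (F := fun ys => chain (mx60 X) (bits NE) ys idle idle
  *+ triangle (bits (rev NW)) ys (bits S))) => [|ys _ h]; last first.
  by rewrite chain60_outer // mul0rn.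
under [in X in _ = X -> _]eq_bigr do rewrite mulmxnE.
rewrite (big_words_bits (F := fun xs => chain (mx0 X) xs (bits (rev NW)) idle idle
  *+ triangle xs (bits NE) (bits S))) => [|xs _ h]; last first.
  by rewrite (@chain0_inner _ _ false) // mul0rn.
rewrite -[in X in _ = X -> _]big_words_rev.
under [in X in X = _ -> _]eq_bigr do rewrite chain60_hop.
rewrite [in X in _ = X -> _]big_seq.
under [in X in _ = X -> _]eq_bigr => w /[!mem_words] /eqP hw.
  rewrite (@chain0_hop _ _ false _ _ false) size_rev hNW -mulrnAr -/(hopX _ _).
  rewrite hopX_rev ?hNW //. over.
rewrite -big_seq -big_distrr /= => h.
exact: mulXnI h.
Qed.

Local Close Scope ring_scope.

(** * Label counts and the absence of 10 on the middle line *)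

Lemma sum_neq0 (I : Type) (r : seq I) (F : I -> nat) :
  \sum_(i <- r) F i != 0 -> exists i, F i != 0.
Proof.
elim: r => [|i r IH]; rewrite ?big_nil ?big_cons //.
by rewrite addn_eq0 negb_and => /orP[h|/IH//]; exists i.
Qed.

(** In an allowed piece, a 0 on the 60 degree edge and a 1 on the 120 degree edge occur exactly once
    in total, or not at all if the horizontal edge is 10. Comparing the two triangles on a common
    diagonal gives a conservation law. *)
Lemma cell_count y x y' m : cell y x y' m != 0 ->
  (x == L0) + (y' == L1) = (y == L1) + (m == L0).
Proof.
move=> /sum_neq0[z]; rewrite muln_eq0 negb_or.
by case: x; case: y; case: y'; case: m; case: z.
Qed.

Lemma upper_strip_count x ys ys' z : upper_strip x ys ys' z != 0 ->
  (x == L0) + count_mem L1 ys' = count_mem L1 ys + (z != L10).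
Proof.
elim: ys ys' x => [|y ys IH] [|y' ys'] x //=.
  case: ys' => // h; rewrite /= addn0 add0n.
  by case: x h; case: y'; case: z.
move=> /sum_neq0[m]; rewrite muln_eq0 negb_or => /andP[/cell_count h /IH h'].
by rewrite addnA h -addnA h' addnA.
Qed.

Lemma triangle_count_labels xs ys zs : triangle xs ys zs != 0 ->
  count_mem L0 xs + count_mem L1 ys = count (predC1 L10) zs.
Proof.
elim: xs ys zs => [|x xs IH] ys [|z zs] //=; first by case: ys.
move=> /sum_neq0[v]; rewrite muln_eq0 negb_or.
by move=> /andP[/upper_strip_count h /IH h']; rewrite addnAC h addnAC (addnC (count _ v)) h' addnC.
Qed.

(** For equal contents, the zeros of [NW] and the ones of [NE] add up to the side length, so every
    bottom label must differ from 10. *)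
Lemma triangle_count0 NW NE S :
  size S = size NW -> size NE = size NW -> count_mem true NW = count_mem true NE ->
  L10 \in S -> triangle_count NW NE S = 0.
Proof.
move=> hS hNE hc h; apply/eqP; apply: contraTT h => /triangle_count_labels.
rewrite -rev_bits count_rev /bits !count_map.
rewrite (eq_count (a2 := predC (pred1 true))) => [|[]//].
rewrite [in X in _ + X = _](eq_count (a2 := pred1 true)) => [|[]//].
rewrite -hc addnC count_predC -hS -has_pred1 => h.
rewrite has_count -leqNgt leqn0 -(eqn_add2r (count (predC1 L10) S)).
by rewrite count_predC -h.
Qed.

Local Open Scope ring_scope.

Lemma rhombus_NW_NE n SW NW NE SE :
  size NW = n -> size NE = n -> count_mem true NW = count_mem true NE ->
  \sum_(w <- words bool n) hopX NW w *+ rhombus_count SW w NE SE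
  = \sum_(w <- words bool n) hopX NE w *+ rhombus_count SW NW w SE.
Proof.
move=> hNW hNE hc.
have split_sum NW' NE' : size NW' = n -> size NE' = n ->
    rhombus_count SW NW' NE' SE = (\sum_(S <- words label n)
      triangle_count NW' NE' S * lower_part S (bits (rev SW)) [::] (bits SE))%N.
  move=> h1 h2; rewrite /rhombus_count -[bits NE']cats0 rhombus_split.
    by rewrite size_map size_rev h1.
  by rewrite !size_map size_rev h1 h2.
have sum_l (w : seq bool) (F : seq bool -> {poly int}) (N : seq bool -> seq label -> nat) (L : seq label -> nat) :
    (\sum_(v <- words bool n) F v *+ (\sum_(S <- words label n) N v S * L S)%N)
   = \sum_(S <- words label n) (\sum_(v <- words bool n) F v *+ N v S) *+ L S.
  under [RHS]eq_bigr do rewrite -sumrMnl.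
  rewrite [RHS]exchange_big; apply: eq_bigr => v _ /=.
  by rewrite -sumrMnr; apply: eq_bigr => S _; rewrite mulrnA.
transitivity (\sum_(w <- words bool n) hopX NW w *+ (\sum_(S <- words label n)
      triangle_count w NE S * lower_part S (bits (rev SW)) [::] (bits SE))%N).
  rewrite big_seq [RHS]big_seq; apply: eq_bigr => w; rewrite mem_words => /eqP hw.
  by rewrite split_sum.
transitivity (\sum_(w <- words bool n) hopX NE w *+ (\sum_(S <- words label n)
      triangle_count NW w S * lower_part S (bits (rev SW)) [::] (bits SE))%N);
  last first.
  rewrite big_seq [RHS]big_seq; apply: eq_bigr => w; rewrite mem_words => /eqP hw.
  by rewrite split_sum.
rewrite !sum_l // big_seq [RHS]big_seq; apply: eq_bigr => S.
rewrite mem_words => /eqP hS; congr (_ *+ _).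
(* If the middle line carries a 10, both sides vanish: hops preserve content, so every [w] that
   could contribute satisfies the hypotheses of [triangle_count0]. *)
have [h|/bitsP[S' eS]] := boolP (L10 \in S); last first.
  by rewrite eS (triangle_NW_NE hNW hNE) // -hS eS size_map.
rewrite !(big_seq _ _ (words bool n)) !big1 // => w; rewrite mem_words => /eqP hw.
  have [->|/hop_count e] := eqVneq (hopX NE w) 0; first by rewrite mul0rn.
  rewrite triangle_count0 ?mulr0n // ?hS ?hw ?hNW // hc.
  by move: e; rewrite !addn0.
have [->|/hop_count e] := eqVneq (hopX NW w) 0; first by rewrite mul0rn.
rewrite triangle_count0 ?mulr0n // ?hS ?hw ?hNE // -hc.
by move: e; rewrite !addn0.
Qed.

(** * Cyclicity and symmetry *)

Definition sorted_word k m := nseq k false ++ nseq m true.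

Lemma hop_nseq_true m w : hopX (nseq m true) w = (w == nseq m true)%:R.
Proof.
rewrite /hopX; by elim: m w => [|m IH] [|[] w] //=.
Qed.

Lemma hop_carry_sorted k m w :
  hop X true (sorted_word k m.+1) w false
  = X ^+ k.+1 *+ (w == sorted_word k.+1 m).
Proof.
elim: k w => [|k IH] [|[] w] //=; rewrite ?mulr0n //.
  rewrite -[hop _ _ _ _ _]/(hopX _ _) hop_nseq_true eqseq_cons expr1.
  by rewrite mulr_natr.
by rewrite IH mulrnAr -exprS.
Qed.

Lemma hop_carry_false k w : hop X true (nseq k false) w false = 0.
Proof. by elim: k w => [|k IH] [|[] w] //=; rewrite IH mulr0. Qed.

(** Only the first 1 has zeros in front of it, and there are k of them. *)
Lemma coef_hop_sorted_gt k m w d : (k < d)%N -> (hopX (sorted_word k m) w)`_d = 0.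
Proof.
elim: k w m => [|k IH] w m hd.
  rewrite hop_nseq_true; case: d hd => // d _.
  by rewrite coefMn coef1 mul0rn.
case: w => [|[] w]; rewrite ?coef0 //; last exact: (IH w m (ltnW hd)).
rewrite /hopX /=; case: m => [|m].
  by rewrite cats0 hop_carry_false coef0.
rewrite [nseq _ _ ++ _]/(sorted_word k m.+1) hop_carry_sorted coefMn coefXn.
by rewrite gtn_eqF ?mul0rn.
Qed.

(** The only move of k steps takes the first 1 to the front. *)
Lemma coef_hop_sorted k m w :
  (hopX (sorted_word k m.+1) w)`_k = (w == true :: sorted_word k m)%:R.
Proof.
case: k => [|k].
  by rewrite hop_nseq_true coefMn coef1.
case: w => [|[] w]; rewrite ?coef0 // eqseq_cons.
  by rewrite /hopX /= hop_carry_sorted coefMn coefXn eqxx.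
by apply: (@coef_hop_sorted_gt k m.+1 w).
Qed.

(* Strings starting with 1 span a subspace stable under the H_d, whose
   generator 1 0^k 1^m is reached from 0^k 1^(m+1) by [k] steps; in the
   quotient, strings starting with 0 behave like strings one letter shorter. *)
Lemma hop_closed_vanish (K : (seq bool -> int) -> Prop) k m :
  (forall phi, K phi -> phi (sorted_word k m) = 0) ->
  (forall phi d, K phi -> exists2 psi, K psi &
     forall w, size w = (k + m)%N -> count_mem true w = m ->
     psi w = \sum_(w' <- words bool (k + m)%N) (hopX w w')`_d * phi w') ->
  forall phi w, K phi -> size w = (k + m)%N -> count_mem true w = m -> phi w = 0.
Proof.
move: {2}(k + m)%N (erefl (k + m)%N) => n.
elim: n K k m => [|n IH] K k m hn hid hcl phi w hphi hw hc.
  move: hn hid => /eqP; rewrite addn_eq0 => /andP[/eqP k0 /eqP m0].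
  by move: hw; rewrite k0 m0 => /size0nil -> /(_ _ hphi).
have sz_sorted a b : size (sorted_word a b) = (a + b)%N.
  by rewrite size_cat !size_nseq.
have ct_sorted a b : count_mem true (sorted_word a b) = b.
  by rewrite count_cat !count_nseq /= mul0n mul1n.
have hT chi v : K chi -> (size v).+1 = (k + m)%N -> (count_mem true v).+1 = m ->
    chi (true :: v) = 0.
  case: m hn hid hcl {hw hc} => // m hn hid hcl hchi hv [hvc].
  apply: (IH (fun f => exists2 g, K g & forall v, f v = g (true :: v)) k m
    _ _ _ (fun v => chi (true :: v)) v _ _ hvc).
  - by move: hn; rewrite addnS => -[].
  (* Degree [k] is chosen because H_k takes the sorted word to the single word 1 0^k 1^m; so [psi]
     at the sorted word is the value of [g] there. *)
  - move=> f [g hg ->]; have [psi hpsi e] := hcl _ k hg.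
    have := hid _ hpsi; rewrite e ?sz_sorted ?ct_sorted //.
    under eq_bigr do rewrite coef_hop_sorted mulrC mulr_natr eq_sym.
    by rewrite big_words_eq //= sz_sorted addnS.
  - move=> f d [g hg hf]; have [psi hpsi e] := hcl _ d hg.
    exists (fun v => psi (true :: v)); first by exists psi.
    move=> u hu huc; rewrite e /= ?hu ?huc ?addnS // big_wordsS big_boolE.
    (* A leading 1 cannot move, so no word starting with 0 is reached. *)
    rewrite [X in _ + X]big1 ?addr0 => [|w' _]; last by rewrite coef0 mul0r.
    by apply: eq_bigr => w' _; rewrite hf.
  - by exists chi.
  - by move: hv; rewrite addnS => -[].
case: w hw hc => [|[] w]; first by rewrite hn.
  by move=> hw hc; apply: hT.
case: k hn hid hcl hT => [|k] hn hid hcl hT hw hc.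
  move: hw hc => /=; rewrite !add0n => hw hc.
  by have := count_size (pred1 true) w; rewrite hc -hw ltnn.
apply: (IH (fun f => exists2 g, K g & forall v, f v = g (false :: v)) k m
  _ _ _ (fun v => phi (false :: v)) w _ _ hc).
- by move: hn; rewrite addSn => -[].
- by move=> f [g hg ->]; apply: (hid g).
- move=> f d [g hg hf]; have [psi hpsi e] := hcl _ d hg.
  exists (fun v => psi (false :: v)); first by exists psi.
  move=> u hu huc; rewrite e /= ?hu ?huc // addSn big_wordsS big_boolE.
  rewrite big_seq big1 ?add0r => [|w'].
    by apply: eq_bigr => w' _; rewrite hf.
  (* A word starting with 1 arises when a jump lands on the first place. Its content is unchanged,
     so [g] vanishes on it by [hT]. *)
  rewrite mem_words => /eqP hw'; rewrite {1}/hopX /=.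
  have [->|/hop_count] := eqVneq (hop X true u w' false) 0; first by rewrite coef0 mul0r.
  rewrite addn0 addn1 huc => hc'.
  by rewrite hT ?mulr0 ?hw'.
- by exists phi.
- by move: hw => /=; rewrite addSn => -[].
Qed.

Definition has_content (n m : nat) (w : seq bool) : bool :=
  (size w == n) && (count_mem true w == m).

(** For fixed [y], every H_d acting on the argument [x] of the difference [delta y x u] can be moved
    to [u]. By cyclicity the difference then vanishes for all [x] once it vanishes at the sorted
    word. *)
Lemma slot_symmetry k m (F : seq bool -> seq bool -> seq bool -> int) :
  let D := has_content (k + m)%N m in
  let hops d x (f : seq bool -> int) :=
    \sum_(w <- words bool (k + m)%N) (hopX x w)`_d * f w in
  (forall d x y u, D x -> D y -> D u ->
     hops d x (fun w => F w y u) = hops d y (fun w => F x w u)) ->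
  (forall d x y u, D x -> D y -> D u ->
     hops d x (fun w => F w y u) = hops d u (fun w => F x y w)) ->
  forall x y u, D x -> D y -> D u -> F x y u = F y x u.
Proof.
move=> D hops h12 h13.
have hopD x w d : D x -> w \in words bool (k + m)%N -> ~~ D w -> (hopX x w)`_d = 0.
  rewrite mem_words => /andP[_ /eqP hx] hw; rewrite /D /has_content hw /= => hc.
  have [->|/hop_count] := eqVneq (hopX x w) 0; first by rewrite coef0.
  by rewrite !addn0 hx => e; rewrite -e eqxx in hc.
have hopsE d x f g : D x -> (forall w, D w -> f w = g w) -> hops d x f = hops d x g.
  move=> hx h; rewrite /hops big_seq [RHS]big_seq; apply: eq_bigr => w hw.
  by have [/h->//|/(hopD _ _ d hx hw)->] := boolP (D w); rewrite !mul0r.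
have Dsorted : D (sorted_word k m).
  by rewrite /D /has_content size_cat !size_nseq count_cat !count_nseq mul0n mul1n !eqxx.
pose delta y x u := F x y u - F y x u.
(* Moving an operator to [u] replaces one [u] by several, so closedness requires linear combinations
   over [u]; the coefficients are supported on [D], where the moves are available. *)
pose K y (phi : seq bool -> int) := exists2 c : seq bool -> int,
  forall u, ~~ D u -> c u = 0 &
  forall x, D x -> phi x = \sum_(u <- words bool (k + m)%N) c u * delta y x u.
have delta_in_K y u : D u -> K y (fun x => delta y x u).
  move=> hu; exists (fun v => (u == v)%:R).
    by move=> v; case: eqP => // <-; rewrite hu.
  move=> x _; under eq_bigr do rewrite mulr_natl.
  by rewrite big_words_eq //; case/andP: hu => /eqP.
have deltaE d x y u : D x -> D y -> D u ->
    hops d x (fun w => delta y w u) = hops d u (fun w => delta y x w).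
  move=> hx hy hu; rewrite /hops /delta.
  under eq_bigr do rewrite mulrBr; under [RHS]eq_bigr do rewrite mulrBr.
  (* In the second term of [delta] the argument [x] sits in slot 2: it reaches slot 3 by way of slot
     1. *)
  by rewrite !sumrB -!/(hops _ _ _) (h13 d x y u) // -(h13 d y x u) // (h12 d y x u).
have Kclosed y phi d : D y -> K y phi -> exists2 psi, K y psi &
     forall w, size w = (k + m)%N -> count_mem true w = m ->
     psi w = \sum_(w' <- words bool (k + m)%N) (hopX w w')`_d * phi w'.
  move=> hy [c hc hphi]; exists (fun x => hops d x phi) => //.
  (* The coefficients are transformed by the transpose of H_d. *)
  exists (fun w => \sum_(u <- words bool (k + m)%N) c u * (hopX u w)`_d *+ D w).
    by move=> w hw; rewrite big1 // => u _; rewrite (negbTE hw).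
  move=> x hx; rewrite (hopsE _ _ _ _ hx hphi) /hops.
  under eq_bigr do rewrite big_distrr /=.
  rewrite exchange_big /=.
  under [RHS]eq_bigr do rewrite big_distrl /=.
  rewrite [RHS]exchange_big; apply: eq_bigr => u _ /=.
  have [hu|/hc cu] := boolP (D u); last first.
    by rewrite !big1 // => w _; rewrite cu ?(mul0r, mul0rn, mulr0).
  transitivity (c u * hops d x (fun w => delta y w u)).
    by rewrite big_distrr; apply: eq_bigr => w _ /=; rewrite mulrCA.
  rewrite deltaE // big_distrr big_seq [RHS]big_seq; apply: eq_bigr => w hw /=.
  by have [_|/(hopD _ _ d hu hw)->] := boolP (D w); rewrite mulrA ?mulr0 ?mul0rn.
have vanish y : D y -> (forall u, D u -> delta y (sorted_word k m) u = 0) ->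
    forall x u, D x -> D u -> F x y u = F y x u.
  move=> hy hid x u /andP[/eqP hx /eqP hxc] hu; apply/eqP; rewrite -subr_eq0; apply/eqP.
  apply: (hop_closed_vanish _ (fun phi d => @Kclosed y phi d hy) (delta_in_K y u hu) hx hxc).
  move=> phi [c hc ->] //; rewrite big1 // => v _.
  by have [/hid->|/hc->] := boolP (D v); rewrite ?mulr0 ?mul0r.
(* Two passes: the base value for [y] is an exchange of [y] with the sorted word, and that exchange
   has a base value with two equal arguments. *)
move=> x y u hx hy hu; apply: (vanish) => // v hv; apply/eqP; rewrite subr_eq0; apply/eqP.
by apply/esym/vanish => // w hw; rewrite /delta subrr.
Qed.

Local Close Scope ring_scope.

(** * Labelings as sums over strips *)

Section Rotation.
Variable a : nat.

Definition rotate180 (P : labeling a) : labeling a :=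
  Labeling [ffun p => edge60 P (rev_ord p.1, rev_ord p.2)]
           [ffun p => edge120 P (rev_ord p.1, rev_ord p.2)]
           [ffun p => edge0 P (rev_ord p.1, rev_ord p.2)].

Lemma rotate180K : involutive rotate180.
Proof.
by case=> e f g; congr Labeling; apply/ffunP => -[i j]; rewrite !ffunE /= !rev_ordK.
Qed.

Lemma rev_lo (i : 'I_a) : rev_ord (lo i) = hi (rev_ord i).
Proof. by apply: val_inj; rewrite /= /bump /= subSS add1n subnSK. Qed.

Lemma rev_hi (i : 'I_a) : rev_ord (hi i) = lo (rev_ord i).
Proof. by rewrite -[i]rev_ordK -rev_lo !rev_ordK. Qed.

Lemma rev_ord0 : rev_ord ord0 = ord_max :> 'I_a.+1.
Proof. by apply: val_inj; rewrite /= subn1. Qed.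

Lemma rev_ord_max : rev_ord ord_max = ord0 :> 'I_a.+1.
Proof. by apply: val_inj; rewrite /= subnn. Qed.

Lemma is_puzzle_rotate180 SW NW NE SE P :
  is_puzzle SW NW NE SE P -> is_puzzle NE SE SW NW (rotate180 P).
Proof.
move=> /andP[/forallP hb /forallP ht]; apply/andP; split.
  apply/forallP => k; rewrite !ffunE /= rev_ord0 rev_ord_max !rev_ordK.
  by case/and4P: (hb k) => -> -> -> ->.
apply/forallP => i; apply/forallP => j.
have /forallP/(_ (rev_ord j)) := ht (rev_ord i).
rewrite /down_ok /up_ok !ffunE /= !rev_lo !rev_hi.
set x := edge120 _ _; set y := edge0 _ _; set z := edge60 _ _.
set x' := edge60 _ _; set z' := edge120 _ _.
move=> /andP[]; clearbody x y z x' z'.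
by case: x; case: y; case: z => // _; case: x'; case: z'.
Qed.

Lemma Rh_rotate180 (SW NW NE SE : a.-tuple bool) :
  Rh SW NW NE SE = Rh NE SE SW NW.
Proof.
suff le (SW' NW' NE' SE' : a.-tuple bool) : Rh SW' NW' NE' SE' <= Rh NE' SE' SW' NW'.
  by apply/eqP; rewrite eqn_leq !le.
rewrite /Rh -(card_imset _ (inv_inj rotate180K)); apply: subset_leq_card.
apply/subsetP => _ /imsetP[P + ->]; rewrite !inE; exact: is_puzzle_rotate180.
Qed.

End Rotation.

(** * Sums over finite functions *)

Section FunctionSums.
Variable S : finType.

Definition ffun_rcons n (r : {ffun 'I_n -> S}) (s : S) : {ffun 'I_n.+1 -> S} :=
  [ffun i => if unlift ord_max i is Some j then r j else s].

Lemma ffun_rcons_lift n (r : {ffun 'I_n -> S}) s j :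
  ffun_rcons r s (lift ord_max j) = r j.
Proof. by rewrite ffunE liftK. Qed.

Lemma ffun_rcons_max n (r : {ffun 'I_n -> S}) s : ffun_rcons r s ord_max = s.
Proof. by rewrite ffunE unlift_none. Qed.

Lemma sum_ffunS n (F : {ffun 'I_n.+1 -> S} -> nat) :
  \sum_r F r = \sum_s \sum_r F (ffun_rcons r s).
Proof.
rewrite pair_bigA /=; apply: (reindex (fun p => ffun_rcons p.2 p.1)).
apply: onW_bij; exists (fun r : {ffun 'I_n.+1 -> S} =>
  (r ord_max, [ffun j : 'I_n => r (lift ord_max j)])).
  move=> [s r] /=; rewrite ffun_rcons_max; congr (_, _).
  by apply/ffunP => j; rewrite ffunE ffun_rcons_lift.
move=> r; apply/ffunP => i /=.
by case: (unliftP ord_max i) => [j|] ->; rewrite ?ffun_rcons_lift ?ffun_rcons_max ?ffunE.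
Qed.

Lemma sum_ffun0 (F : {ffun 'I_0 -> S} -> nat) r0 : \sum_r F r = F r0.
Proof. by apply: big_pred1 => r; apply/esym/eqP/ffunP => -[]. Qed.

(** Strips and their cells are peeled off from the largest index downwards, hence the reversal. *)
Definition values n (f : 'I_n -> S) : seq S := rev [seq f j | j <- enum 'I_n].

Lemma valuesS n (f : 'I_n.+1 -> S) :
  values f = f ord_max :: values (fun j => f (widen_ord (leqnSn n) j)).
Proof. by rewrite /values enum_ordSr map_rcons rev_rcons -map_comp. Qed.

Lemma values0 (f : 'I_0 -> S) : values f = [::].
Proof. by apply: size0nil; rewrite size_rev size_map size_enum_ord. Qed.

Lemma eq_values n (f g : 'I_n -> S) : f =1 g -> values f = values g.
Proof. by move=> h; rewrite /values (eq_map h). Qed.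

Lemma widen_lift n (j : 'I_n) : widen_ord (leqnSn n) j = lift ord_max j.
Proof. by apply: val_inj; rewrite /= /bump leqNgt ltn_ord. Qed.

Lemma values_rcons n (r : {ffun 'I_n -> S}) s :
  values (ffun_rcons r s) = s :: values r.
Proof.
rewrite valuesS ffun_rcons_max; congr (_ :: _); apply: eq_values => j.
by rewrite widen_lift ffun_rcons_lift.
Qed.

Lemma values_inj n (r r' : {ffun 'I_n -> S}) :
  (values r == values r') = (r == r').
Proof.
apply/eqP/eqP => [|-> //] /(can_inj (@revK _)) /eq_in_map h.
by apply/ffunP => j; apply: h; rewrite mem_enum.
Qed.

Lemma sum_words_values n (F : seq S -> nat) :
  \sum_(w <- words S n) F w = \sum_(r : {ffun 'I_n -> S}) F (values r).
Proof.
elim: n F => [|n IH] F.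
  have r0 : {ffun 'I_0 -> S} by apply: finfun => -[].
  by rewrite (sum_ffun0 _ r0) values0 big_words0.
rewrite big_wordsS sum_ffunS; apply: eq_bigr => s _; rewrite IH.
by apply: eq_bigr => r _; rewrite values_rcons.
Qed.

Lemma prod_rcons n (G : 'I_n.+1 -> S -> S -> nat) (r : {ffun 'I_n.+1 -> S}) s :
  \prod_j G j (ffun_rcons r s (lo j)) (ffun_rcons r s (hi j))
  = (\prod_(j < n) G (widen_ord (leqnSn n) j) (r (lo j)) (r (hi j)))
    * G ord_max (r ord_max) s.
Proof.
rewrite big_ord_recr /=; congr (_ * _).
  apply: eq_bigr => j _; congr G.
    rewrite -[RHS](ffun_rcons_lift r s) -widen_lift; congr (ffun_rcons r s _).
  rewrite -[RHS](ffun_rcons_lift r s) -widen_lift; congr (ffun_rcons r s _).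
  exact: val_inj.
congr G; first by rewrite /lo widen_lift ffun_rcons_lift.
rewrite -[RHS](ffun_rcons_max r s); congr (ffun_rcons _ _ _).
by apply: val_inj.
Qed.

Lemma rcons_ord0 n (r : {ffun 'I_n.+1 -> S}) s : ffun_rcons r s ord0 = r ord0.
Proof.
by rewrite -(ffun_rcons_lift r s); congr (ffun_rcons _ _ _); apply: val_inj.
Qed.

End FunctionSums.

(** The labels between consecutive cells, summed one by one in the recursion, are gathered in [r],
    with [x] at the top index and [w] at index 0. *)
Lemma strip_sum n (f g : 'I_n -> label) x w :
  strip x (values f) (values g) w
  = \sum_(r : {ffun 'I_n.+1 -> label}) (r ord0 == w) * (r ord_max == x)
      * \prod_j cell (f j) (r (hi j)) (g j) (r (lo j)).
Proof.
elim: n f g x => [|n IH] f g x.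
  rewrite !values0 sum_ffunS /=.
  have r0 : {ffun 'I_0 -> label} by apply: finfun => -[].
  under eq_bigr do rewrite (sum_ffun0 _ r0) big_ord0 muln1.
  rewrite (bigD1 x) //= big1 ?addn0 => [|s /negbTE hs].
    by rewrite (_ : ord0 = ord_max) ?ffun_rcons_max ?eqxx ?muln1 //; apply: val_inj.
  by rewrite ffun_rcons_max hs muln0.
rewrite !valuesS /= sum_ffunS [RHS](bigD1 x) //= [X in _ = _ + X]big1 ?addn0; last first.
  by move=> s /negbTE hs; rewrite big1 // => r _; rewrite ffun_rcons_max hs muln0.
transitivity (\sum_(r : {ffun 'I_n.+1 -> label}) \sum_m
   (r ord_max == m) * (cell (f ord_max) x (g ord_max) m * ((r ord0 == w) *
   \prod_(j < n) cell (f (widen_ord (leqnSn n) j)) (r (hi j))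
                      (g (widen_ord (leqnSn n) j)) (r (lo j))))).
  rewrite exchange_big; apply: eq_bigr => m _ /=; rewrite IH big_distrr.
  apply: eq_bigr => r _ /=.
  by rewrite [in LHS](mulnC (r ord0 == w)) -[in LHS]mulnA mulnCA.
apply: eq_bigr => r _.
rewrite (bigD1 (r ord_max)) //= [X in _ + X = _]big1 ?addn0 => [|m]; last first.
  by rewrite eq_sym => /negbTE->.
rewrite (prod_rcons (fun j p q => cell (f j) q (g j) p)) ffun_rcons_max rcons_ord0.
by rewrite !eqxx mul1n muln1 mulnC mulnA.
Qed.

Lemma rhombus_sum a n (x w : 'I_n -> label) (p0 p1 : {ffun 'I_a -> label}) :
  rhombus (values x) (values p0) (values p1) (values w)
  = \sum_(r : {ffun 'I_n.+1 -> {ffun 'I_a -> label}})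
      (r ord0 == p0) * (r ord_max == p1)
      * \prod_i strip (x i) (values (r (lo i))) (values (r (hi i))) (w i).
Proof.
elim: n x w p1 => [|n IH] x w p1.
  rewrite !values0 sum_ffunS /= values_inj.
  have r0 : {ffun 'I_0 -> {ffun 'I_a -> label}} by apply: finfun => -[].
  under eq_bigr do rewrite (sum_ffun0 _ r0) big_ord0 muln1.
  rewrite (bigD1 p1) //= big1 ?addn0 => [|s /negbTE hs].
    rewrite (_ : ord0 = ord_max) ?ffun_rcons_max ?eqxx ?muln1 1?eq_sym //.
    exact: val_inj.
  by rewrite ffun_rcons_max hs muln0.
rewrite [values x]valuesS [values w]valuesS /= sum_ffunS.
rewrite [RHS](bigD1 p1) //= [X in _ = _ + X]big1 ?addn0; last first.
  by move=> s /negbTE hs; rewrite big1 // => r _; rewrite ffun_rcons_max hs muln0.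
have -> : size (values p1) = a by rewrite size_rev size_map size_enum_ord.
rewrite sum_words_values.
transitivity (\sum_(r : {ffun 'I_n.+1 -> {ffun 'I_a -> label}}) \sum_p
   (r ord_max == p) * (strip (x ord_max) (values p) (values p1) (w ord_max)
    * ((r ord0 == p0) * \prod_(i < n) strip (x (widen_ord (leqnSn n) i))
     (values (r (lo i))) (values (r (hi i))) (w (widen_ord (leqnSn n) i))))).
  rewrite exchange_big; apply: eq_bigr => p _ /=; rewrite IH big_distrr.
  apply: eq_bigr => r _ /=.
  by rewrite [in LHS](mulnC (r ord0 == p0)) -[in LHS]mulnA mulnCA.
apply: eq_bigr => r _.
rewrite (bigD1 (r ord_max)) //= [X in _ + X = _]big1 ?addn0 => [|m]; last first.
  by rewrite eq_sym => /negbTE->.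
rewrite (prod_rcons (fun i (p q : {ffun 'I_a -> label}) =>
  strip (x i) (values p) (values q) (w i))).
rewrite ffun_rcons_max rcons_ord0.
by rewrite !eqxx mul1n muln1 mulnC mulnA.
Qed.

Lemma prod_nat_of_bool (I : finType) (b : I -> bool) :
  \prod_i (b i : nat) = [forall i, b i] :> nat.
Proof.
case: forallP => [h|/forallP]; first by rewrite big1 // => i _; rewrite h.
by rewrite negb_forall => /existsP[i /negbTE hi]; rewrite (bigD1 i) //= hi.
Qed.

(** * The number of puzzles as an iterated sum *)

Section Counting.
Variables (a : nat) (SW NW NE SE : a.-tuple bool).

Let lab (u : a.-tuple bool) (k : 'I_a) := label_of_bit (tnth u k).

Lemma values_rev_tuple (u : a.-tuple bool) : bits (rev u) = values (lab u).
Proof.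
by rewrite /bits map_rev -[in LHS](map_tnth_enum u) -map_comp.
Qed.

Lemma values_tuple (u : a.-tuple bool) :
  bits u = values (fun k => lab u (rev_ord k)).
Proof.
rewrite -[tval u]revK (values_rev_tuple [tuple of rev u]); apply: eq_values => k.
by rewrite /lab !(tnth_nth false) /= nth_rev ?size_tuple.
Qed.

Definition labeling_of_rows
    (q : {ffun 'I_a -> {ffun 'I_a.+1 -> label}})
    (r : {ffun 'I_a.+1 -> {ffun 'I_a -> label}})
    (z : {ffun 'I_a * 'I_a -> label}) : labeling a :=
  Labeling [ffun p => q p.1 p.2] [ffun p => r p.1 p.2] z.

Lemma sum_labeling (F : labeling a -> nat) :
  \sum_P F P = \sum_r \sum_q \sum_z F (labeling_of_rows q r z).
Proof.
rewrite pair_bigA pair_bigA /=.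
apply: (reindex (fun t : ({ffun 'I_a.+1 -> {ffun 'I_a -> label}}
    * {ffun 'I_a -> {ffun 'I_a.+1 -> label}}) * {ffun 'I_a * 'I_a -> label} =>
  labeling_of_rows t.1.2 t.1.1 t.2)).
apply: onW_bij; exists (fun P => ([ffun i => [ffun j => edge120 P (i, j)]],
  [ffun i => [ffun j => edge60 P (i, j)]], edge0 P)).
  move=> [[r q] z]; congr (_, _, _); apply/ffunP => i; apply/ffunP => j;
  by rewrite !ffunE.
by case=> e f z; congr Labeling; apply/ffunP => -[i j]; rewrite !ffunE.
Qed.

Lemma Rh_rhombus_count : Rh SW NW NE SE = rhombus_count SW NW NE SE.
Proof.
rewrite /rhombus_count !values_rev_tuple !values_tuple.
rewrite -(eq_values (ffunE (lab SW))) -(eq_values (ffunE (fun k => lab NE (rev_ord k)))).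
rewrite rhombus_sum /Rh cardsE -sum1_card big_mkcond sum_labeling /=.
apply: eq_bigr => r _.
under [in RHS]eq_bigr do rewrite strip_sum.
(* A product over strips of sums over their 60 degree labels becomes one sum over families [q]; the
   diagonals [z] of the cells are treated likewise below. *)
rewrite bigA_distr_bigA big_distrr; apply: eq_bigr => q _ /=.
transitivity (\sum_(z : {ffun 'I_a * 'I_a -> label})
  (r ord0 == [ffun k => lab SW k])
    * (r ord_max == [ffun k => lab NE (rev_ord k)])
    * ((\prod_i ((q i ord0 == lab SE (rev_ord i)) * (q i ord_max == lab NW i)))
    * \prod_p (allowed_piece (r (lo p.1) p.2) (z p) (q p.1 (lo p.2))
               * allowed_piece (q p.1 (hi p.2)) (r (hi p.1) p.2) (z p)))); last first.
  rewrite -!big_distrr /= [in RHS]big_split /=; congr (_ * (_ * _)).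
  rewrite pair_bigA /= /cell bigA_distr_bigA /=.
  by [].
apply: eq_bigr => z _.
under [X in _ * (X * _)]eq_bigr do rewrite mulnb.
under [X in _ * (_ * X)]eq_bigr do rewrite mulnb.
rewrite !prod_nat_of_bool !mulnb.
rewrite (_ : (if _ then 1 else 0) = is_puzzle SW NW NE SE (labeling_of_rows q r z)).
  congr nat_of_bool; apply/andP/idP.
    move=> [/forallP hb /forallP ht].
    apply/and3P; split.
    - apply/andP; split; apply/eqP/ffunP => k; rewrite ffunE.
        by have := hb k; rewrite !ffunE /= => /and4P[/eqP-> _ _ _].
      by have := hb (rev_ord k); rewrite !ffunE /= rev_ordK => /and4P[_ _ /eqP-> _].
    - apply/forallP => i; apply/andP; split.
        by have := hb (rev_ord i); rewrite !ffunE /= rev_ordK => /and4P[_ _ _ ->].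
      by have := hb i; rewrite !ffunE /= => /and4P[_ -> _ _].
    apply/forallP => -[i j]; have /forallP/(_ j) := ht i.
    by rewrite /down_ok /up_ok !ffunE.
  move=> /and3P[/andP[/eqP h0 /eqP h1] /forallP hb /forallP ht]; split.
    apply/forallP => k; rewrite !ffunE /= h0 h1 !ffunE !eqxx /= rev_ordK eqxx.
    have /andP[_ ->] := hb k; have /andP[] := hb (rev_ord k).
    by rewrite rev_ordK => ->.
  apply/forallP => i; apply/forallP => j; have := ht (i, j).
  by rewrite /down_ok /up_ok !ffunE.
by rewrite unfold_in -/(is_puzzle _ _ _ _ _); case: is_puzzle.
Qed.

End Counting.

(** * Moves between sides and exchanges of two sides *)

Local Open Scope ring_scope.

Lemma rhombus_count_rotate n SW NW NE SE :
  size SW = n -> size NW = n -> size NE = n -> size SE = n ->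
  rhombus_count SW NW NE SE = rhombus_count NE SE SW NW.
Proof.
move=> /eqP hSW /eqP hNW /eqP hNE /eqP hSE.
have := Rh_rotate180 (Tuple hSW) (Tuple hNW) (Tuple hNE) (Tuple hSE).
by rewrite !Rh_rhombus_count.
Qed.

Section Moves.
Variables n m : nat.
Local Notation D := (has_content n m).

Definition hop_sum d x (f : seq bool -> int) :=
  \sum_(w <- words bool n) (hopX x w)`_d * f w.

Let hop_sum_coef x y (f g : seq bool -> nat) :
  \sum_(w <- words bool n) hopX x w *+ f w
    = \sum_(w <- words bool n) hopX y w *+ g w ->
  forall d, hop_sum d x (fun w => (f w)%:R) = hop_sum d y (fun w => (g w)%:R).
Proof.
move=> h d; have := congr1 (fun p : {poly int} => p`_d) h.
rewrite !coef_sum /hop_sum => e.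
under eq_bigr do rewrite mulr_natr -coefMn.
by under [RHS]eq_bigr do rewrite mulr_natr -coefMn.
Qed.

Let F SW NW NE SE : int := (rhombus_count SW NW NE SE)%:R.

Lemma move_NW_SE d SW NW NE SE : D SW -> D NW -> D NE -> D SE ->
  hop_sum d NW (fun w => F SW w NE SE) = hop_sum d SE (fun w => F SW NW NE w).
Proof.
move=> /andP[/eqP ? _] /andP[/eqP ? _] /andP[/eqP ? _] /andP[/eqP ? _].
by apply: hop_sum_coef; apply: rhombus_NW_SE.
Qed.

Lemma move_NW_NE d SW NW NE SE : D NW -> D NE ->
  hop_sum d NW (fun w => F SW w NE SE) = hop_sum d NE (fun w => F SW NW w SE).
Proof.
move=> /andP[/eqP ? /eqP hNW] /andP[/eqP ? /eqP hNE].
by apply: hop_sum_coef; apply: rhombus_NW_NE; rewrite // hNW.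
Qed.

(** The half-turn takes NW to SE and NE to SW, so this is [move_NW_NE] rotated and read
    backwards. *)
Lemma move_SW_SE d SW NW NE SE : D SW -> D NW -> D NE -> D SE ->
  hop_sum d SW (fun w => F w NW NE SE) = hop_sum d SE (fun w => F SW NW NE w).
Proof.
move=> hSW /andP[/eqP sNW _] /andP[/eqP sNE _] hSE.
have /andP[/eqP sSW _] := hSW; have /andP[/eqP sSE _] := hSE.
transitivity (hop_sum d SW (fun w => F NE SE w NW)).
  rewrite /hop_sum big_seq [RHS]big_seq; apply: eq_bigr => w.
  by rewrite mem_words /F => /eqP sw; rewrite (@rhombus_count_rotate n).
rewrite -move_NW_NE // /hop_sum big_seq [RHS]big_seq; apply: eq_bigr => w.
by rewrite mem_words /F => /eqP sw; rewrite (@rhombus_count_rotate n).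
Qed.

Hypothesis le_mn : (m <= n)%N.

(** Each exchange uses a third side to which operators move: SE for NW and NE, NE for NW and SE, NW
    for SW and SE. *)
Lemma rhombus_count_swap SW NW NE SE : D SW -> D NW -> D NE -> D SE ->
  [/\ rhombus_count SW NW NE SE = rhombus_count SW NE NW SE,
      rhombus_count SW NW NE SE = rhombus_count SW SE NE NW
    & rhombus_count SW NW NE SE = rhombus_count SE NW NE SW].
Proof.
move=> hSW hNW hNE hSE.
have natz_inj (p q : nat) : p%:R = q%:R :> int -> p = q by rewrite !natz => -[].
have sym (G : seq bool -> seq bool -> seq bool -> int) :
  (forall d x y u, D x -> D y -> D u ->
     hop_sum d x (fun w => G w y u) = hop_sum d y (fun w => G x w u)) ->
  (forall d x y u, D x -> D y -> D u ->
     hop_sum d x (fun w => G w y u) = hop_sum d u (fun w => G x y w)) ->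
  forall x y u, D x -> D y -> D u -> G x y u = G y x u.
  have := @slot_symmetry (n - m)%N m G; rewrite (subnK le_mn); exact.
split; apply: natz_inj.
- apply: (sym (fun x y u => F SW x y u)) => // d x y u hx hy hu.
    exact: move_NW_NE.
  exact: move_NW_SE.
- apply: (sym (fun x y u => F SW x u y)) => // d x y u hx hy hu.
    exact: move_NW_SE.
  exact: move_NW_NE.
apply: (sym (fun x y u => F x u NE y)) => // d x y u hx hy hu.
  exact: move_SW_SE.
by rewrite move_SW_SE // move_NW_SE.
Qed.

End Moves.
Local Close Scope ring_scope.

Theorem theorem6 (a a1 : nat) (ha : a1 <= a)
    (alpha beta gamma delta : a.-tuple bool)
    (halpha : alpha \in binary_strings a a1)
    (hbeta : beta \in binary_strings a a1)
    (hgamma : gamma \in binary_strings a a1)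
    (hdelta : delta \in binary_strings a a1)
    (f : symbol -> symbol) (hf : bijective f) :
  let str := symbol_value alpha beta gamma delta in
  Rh alpha gamma beta delta =
  Rh (str (f Alpha)) (str (f Gamma)) (str (f Beta)) (str (f Delta)).
Proof.
move=> str.
have hstr s : has_content a a1 (str s).
  rewrite /has_content size_tuple eqxx /=.
  by case: s; [move: halpha | move: hbeta | move: hgamma | move: hdelta]; rewrite inE.
pose G s1 s2 s3 s4 := Rh (str s1) (str s2) (str s3) (str s4).
have swap s1 s2 s3 s4 : [/\ G s1 s2 s3 s4 = G s1 s3 s2 s4,
    G s1 s2 s3 s4 = G s1 s4 s3 s2 & G s1 s2 s3 s4 = G s4 s2 s3 s1].
  by rewrite /G !Rh_rhombus_count; apply: (rhombus_count_swap ha).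
have swap23 s1 s2 s3 s4 : G s1 s2 s3 s4 = G s1 s3 s2 s4 by case: (swap s1 s2 s3 s4).
have swap24 s1 s2 s3 s4 : G s1 s2 s3 s4 = G s1 s4 s3 s2 by case: (swap s1 s2 s3 s4).
have swap14 s1 s2 s3 s4 : G s1 s2 s3 s4 = G s4 s2 s3 s1 by case: (swap s1 s2 s3 s4).
have neq s s' : s <> s' -> f s <> f s' by move=> h /(bij_inj hf).
suff e : G Alpha Gamma Beta Delta = G (f Alpha) (f Gamma) (f Beta) (f Delta) by exact: e.
have : f Alpha <> f Beta by exact: neq.
have : f Alpha <> f Gamma by exact: neq.
have : f Alpha <> f Delta by exact: neq.
have : f Beta <> f Gamma by exact: neq.
have : f Beta <> f Delta by exact: neq.
have : f Gamma <> f Delta by exact: neq.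
clearbody G; clear -swap23 swap24 swap14.
(* Non-injective choices are refuted by [congruence]. Otherwise [Alpha] is brought to the first
   place, then [Gamma] to the second; the last two places are exchanged, if necessary, by
   conjugating [swap24] with [swap23]. *)
case: (f Alpha); case: (f Gamma); case: (f Beta); case: (f Delta) => // *;
  first [ congruence
  | match goal with
    | |- _ = G _ _ _ Alpha => rewrite [RHS]swap14
    | |- _ = G _ Alpha _ _ => rewrite [RHS]swap24 [RHS]swap14
    | |- _ = G _ _ Alpha _ => rewrite [RHS]swap23 [RHS]swap24 [RHS]swap14
    | _ => idtac
    end;
    match goal with
    | |- _ = G _ _ Gamma _ => rewrite [RHS]swap23
    | |- _ = G _ _ _ Gamma => rewrite [RHS]swap24
    | _ => idtac
    end;
    first [done | by rewrite [RHS]swap23 [RHS]swap24 [RHS]swap23] ].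
Qed.
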